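(* Let $k\ge5$ be an odd integer and let $\epsilon>0$. Then, as $X\to\infty$, $$\sum_{\substack{0<D<X\\ -D\text{ a fundamental discriminant}}}|H_k(-D)|\gg X^{\frac12+\frac1{k-2}-\epsilon},$$ where the implied constant may depend on $k$ and $\epsilon$.
   Context: For a fundamental discriminant $-D<0$, $H(-D)$ denotes the ideal class group of the imaginary quadratic field of discriminant $-D$, and $H_k(-D)$ denotes the set of elements of order exactly $k$ in $H(-D)$. *)

(* Defs.v *)
From HB Require Import structures.
From mathcomp Require Import all_boot all_order all_algebra all_field.
From mathcomp Require Import all_classical all_reals all_analysis.

Set Implicit Arguments.
Unset Strict Implicit.
Unset Printing Implicit Defensive.

Import Order.TTheory GRing.Theory Num.Theory.
Import numFieldNormedType.Exports.

Local Open Scope classical_set_scope.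
Local Open Scope ring_scope.

Definition squarefree (n : nat) : Prop :=
  forall m : nat, (m ^ 2 %| n)%N -> m = 1%N.

(* The discriminants of quadratic fields; d = 1 (the discriminant of the       *)
(* rational field) is therefore excluded.                                      *)
Definition fundamental_discriminant (d : int) : Prop :=
  [/\ d != 1, (d %% 4)%Z = 1 & squarefree `|d|%N] \/
  exists m : int,
    [/\ d = 4 * m, (m %% 4)%Z = 2 \/ (m %% 4)%Z = 3 & squarefree `|m|%N].

(* The field Q(sqrt d) inside the algebraic numbers. When d is a fundamental   *)
(* discriminant this is the quadratic field of discriminant d.                 *)
Definition quadratic_field (d : int) : set algC :=
  [set x | exists a b : rat, x = ratr a + ratr b * sqrtC d%:~R].

(* Number fields are represented by their set of elements K in algC; all       *)
(* field operations are those of algC.                                         *)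

Definition ring_of_integers (K : set algC) : set algC :=
  [set x | K x /\ x \in Aint].

(* Fractional ideals are nonzero by convention.                                *)
Record fractional_ideal (K I : set algC) : Prop := FractionalIdeal {
  fracid_sub : I `<=` K;
  fracid_0 : I 0;
  fracid_add : forall x y, I x -> I y -> I (x + y);
  fracid_mul : forall a x, ring_of_integers K a -> I x -> I (a * x);
  fracid_neq0 : exists2 x, I x & x != 0;
  fracid_denom : exists2 d, ring_of_integers K d /\ d != 0 &
                   forall x, I x -> ring_of_integers K (d * x)
}.

Definition ideal_mul (I J : set algC) : set algC :=
  [set z | exists (n : nat) (a b : 'I_n -> algC),
     [/\ forall i, I (a i), forall i, J (b i) & z = \sum_(i < n) a i * b i]].

Definition ideal_scale (x : algC) (I : set algC) : set algC :=
  [set x * y | y in I].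

(* The coset of I modulo the principal fractional ideals of K.                 *)
Definition ideal_class (K I : set algC) : set (set algC) :=
  [set J | exists2 x, K x /\ x != 0 & J = ideal_scale x I].

Definition class_group (K : set algC) : set (set (set algC)) :=
  [set ideal_class K I | I in fractional_ideal K].

(* Classes are cosets of the group of principal fractional ideals, so the set  *)
(* of products of their members is again a coset: the product in the quotient. *)
Definition class_mul (A B : set (set algC)) : set (set algC) :=
  [set ideal_mul I J | I in A & J in B].

Definition class_one (K : set algC) : set (set algC) :=
  ideal_class K (ring_of_integers K).

Definition class_exp (K : set algC) (A : set (set algC)) (n : nat) :=
  iter n (class_mul A) (class_one K).

Definition class_has_order (K : set algC) (A : set (set algC)) (n : nat) :=
  [/\ (0 < n)%N, class_exp K A n = class_one K &
      forall m : nat, (0 < m < n)%N -> class_exp K A m <> class_one K].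

Definition classes_of_order (k : nat) (d : int) : set (set (set algC)) :=
  [set A | class_group (quadratic_field d) A /\
           class_has_order (quadratic_field d) A k].

(* Main.v *)
(* If m ^ k = a ^ 2 + n f ^ 2 with n squarefree, n = 1 mod 4, m odd and coprime to a, then for
   alpha = a + f sqrt(-n) the ideal (m, alpha) of Z[sqrt(-n)] satisfies (m, alpha) ^ k = (alpha).
   Its class has order exactly k as soon as m ^ g < n for all proper divisors g of k, and for
   fixed n distinct (m, a) give distinct classes as soon as m m' < n.

   To produce such (m, a), take m of size z ^ 10, a below z ^ (5 k), and let n be the squarefree
   part of m ^ k - a ^ 2. It is at most z ^ (10 (k - 2)), up to a constant, if m ^ k - a ^ 2 is
   divisible by (p r) ^ 2 for some p of size z ^ 6 and r of size z ^ 4. Since m runs over all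
   residues modulo b = p r, counting squares modulo b and lifting square roots modulo b ^ 2 yields
   z ^ (5 k - o(1)) such pairs, which is X ^ (1/2 + 1/(k-2) - o(1)) for X = z ^ (10 (k - 2)).

   Pairs with n too small are negligible. If n < z ^ (5 k - 11), use that m ^ k has few
   representations a ^ 2 + n f ^ 2. Otherwise n < m ^ 2 forces f to be so large that w = f / r, a
   multiple of p, is a square divisor w ^ 2 of m ^ k - a ^ 2 with w in a range where the trivial
   bound for the number of such (m, a) saves a power of z. *)

Require Import Defs.
From mathcomp Require Import all_boot all_order all_algebra cyclic.
From mathcomp Require Import zify ring lra.

Set Implicit Arguments.
Unset Strict Implicit.
Unset Printing Implicit Defensive.

Import Order.TTheory GRing.Theory Num.Theory.

(** * Divisors, residues and square roots *)

Local Open Scope nat_scope.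

Lemma card_le_fibers (T U : finType) (f : T -> U) (A : {set T}) (c : nat) :
  (forall y, #|[set x in A | f x == y]| <= c) -> #|A| <= c * #|f @: A|.
Proof.
move=> fib; rewrite -sum1_card (partition_big_imset f) /= mulnC -sum_nat_const.
apply: leq_sum => y _; apply: leq_trans (fib y); rewrite -sum1_card.
by rewrite [leqRHS](eq_bigl (fun x => (x \in A) && (f x == y))) // => x; rewrite inE.
Qed.

Lemma card_le_divisors (T : finType) (q : nat) (S : {set T}) (g : T -> nat) :
  0 < q -> {in S, forall x, g x %| q} -> {in S &, injective g} ->
  #|S| <= size (divisors q).
Proof.
move=> q0 gq ginj; rewrite cardE -(size_map g).
apply: uniq_leq_size.
  rewrite map_inj_in_uniq ?enum_uniq // => x y.
  by rewrite !mem_enum; apply: ginj.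
move=> y /mapP[x]; rewrite mem_enum => xS ->.
by rewrite -dvdn_divisors // gq.
Qed.

Lemma dvdn_div_gcdl q x y : 0 < q -> q %| x * y -> q %/ gcdn q x %| y.
Proof.
move=> q0 h; have g0 : 0 < gcdn q x by rewrite gcdn_gt0 q0.
rewrite -(dvdn_pmul2l g0) mulnC divnK ?dvdn_gcdl //.
by rewrite muln_gcdl dvdn_gcd dvdn_mulr.
Qed.

(* With z in S fixed, x is recovered from the divisor gcd(q, u z * v x - u x * v z). *)
Lemma card_square_proportional (T : finType) (q : nat) (S : {set T}) (u v : T -> int) :
  odd q ->
  (forall x, x \in S -> coprimez (u x) q%:Z && coprimez (v x) q%:Z) ->
  (forall x y, x \in S -> y \in S ->
     (q%:Z %| ((u x * v y) ^+ 2 - (u y * v x) ^+ 2)%R)%Z) ->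
  (forall x y, x \in S -> y \in S -> (q%:Z %| (u x * v y - u y * v x)%R)%Z -> x = y) ->
  #|S| <= size (divisors q).
Proof.
move=> oq cop sq inj.
case: (set_0Vmem S) => [-> | [z zS]]; first by rewrite cards0.
have q0 : 0 < q by case: q oq {cop sq inj}.
pose X x : int := (u z * v x - u x * v z)%R.
pose X' x : int := (u z * v x + u x * v z)%R.
pose g x := gcdn q `|X x|.
have gX x : ((g x)%:Z %| X x)%Z by rewrite dvdzE /=; apply: dvdn_gcdr.
have gq x : g x %| q by apply: dvdn_gcdl.
have g0 x : 0 < g x by rewrite gcdn_gt0 q0.
have hX' x : x \in S -> ((q %/ g x)%N%:Z %| X' x)%Z.
  move=> xS; have := sq _ _ zS xS.
  have -> : ((u z * v x) ^+ 2 - (u x * v z) ^+ 2 = X x * X' x)%R by rewrite /X /X'; ring.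
  by rewrite !dvdzE /= abszM; apply: dvdn_div_gcdl.
have cz d : d %| q -> coprimez d%:Z (u z) && coprimez d%:Z (v z).
  move=> dq; have /andP[cu cv] := cop _ zS.
  by rewrite ![coprimez d%:Z _]coprimez_sym !(coprimez_dvdr _ cu, coprimez_dvdr _ cv).
have cancel_z d x y : d %| q -> (d%:Z %| ((u x * v y - u y * v x) * v z)%R)%Z ->
    (d%:Z %| (u x * v y - u y * v x)%R)%Z.
  by move=> /cz/andP[_ c]; rewrite Gauss_dvdzl.
apply: (card_le_divisors (g := g)) => // x y xS yS gxy.
apply: inj => //.
(* A common factor divides [X x + X' x = 2 * u z * v x], a unit modulo the odd [q]. So the
   congruence may be checked modulo [g x], where [X x] and [X y] vanish, and modulo [q %/ g x],
   where [X' x] and [X' y] vanish. *)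
have cgq : coprime (g x) (q %/ g x).
  have hd : ((gcdn (g x) (q %/ g x))%:Z %| (2 * u z * v x)%R)%Z.
    have -> : (2 * u z * v x = X x + X' x)%R by rewrite /X /X'; ring.
    apply: rpredD.
      by apply: dvdz_trans (gX x); rewrite dvdzE /= dvdn_gcdl.
    by apply: dvdz_trans (hX' _ xS); rewrite dvdzE /= dvdn_gcdr.
  have dq : gcdn (g x) (q %/ g x) %| q by apply: dvdn_trans (dvdn_gcdl _ _) (gq x).
  have /andP[cu _] := cz _ dq.
  have cv : coprimez (gcdn (g x) (q %/ g x))%:Z (v x).
    by have /andP[_ c] := cop _ xS; rewrite coprimez_sym; apply: coprimez_dvdr c.
  have c2 : coprimez (gcdn (g x) (q %/ g x))%:Z 2.
    rewrite coprimezE /= coprimen2; move: oq; apply: contraTT => od.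
    by rewrite -dvdn2; apply: dvdn_trans dq; rewrite dvdn2.
  have : coprimez (gcdn (g x) (q %/ g x))%:Z (2 * u z * v x)%R.
    by rewrite !coprimezMr c2 cu cv.
  move: hd; rewrite dvdzE coprimezE /coprime => /gcdn_idPl ->.
  by [].
rewrite -[q in (q%:Z %| _)%Z](divnK (gq x)) mulnC PoszM.
rewrite Gauss_dvdz; last by rewrite coprimezE.
apply/andP; split; apply: cancel_z.
- exact: gq.
- have -> : ((u x * v y - u y * v x) * v z = v x * X y - v y * X x)%R.
    by rewrite /X; ring.
  by apply: rpredB; apply: dvdz_mull => //; rewrite gxy.
- by rewrite -[X in _ %| X](divnK (gq x)) dvdn_mulr.
have -> : ((u x * v y - u y * v x) * v z = v y * X' x - v x * X' y)%R.
  by rewrite /X'; ring.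
apply: rpredB; apply: dvdz_mull; first exact: hX'.
by rewrite gxy; apply: hX'.
Qed.

(** * The divisor bound *)

Lemma divisors_mul_le m n : 0 < m -> 0 < n ->
  size (divisors (m * n)) <= size (divisors m) * size (divisors n).
Proof.
move=> m0 n0; rewrite -(size_allpairs pair).
rewrite -(size_map (fun d => (gcdn d m, d %/ gcdn d m)) (divisors (m * n))).
apply: uniq_leq_size.
  rewrite map_inj_in_uniq ?divisors_uniq // => d e _ _ [ge de].
  by rewrite -(divnK (dvdn_gcdl d m)) -(divnK (dvdn_gcdl e m)) de ge.
move=> y /mapP[d]; rewrite -dvdn_divisors ?muln_gt0 ?m0 // => dmn ->.
apply/allpairsP; exists (gcdn d m, d %/ gcdn d m); split => //=.
  by rewrite -dvdn_divisors // dvdn_gcdr.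
rewrite -dvdn_divisors //.
have g0 : 0 < gcdn d m by rewrite gcdn_gt0 m0 orbT.
have h : d %/ gcdn d m %| (m %/ gcdn d m) * n.
  by rewrite -(dvdn_pmul2l g0) mulnA !(mulnC (gcdn d m)) !divnK ?dvdn_gcdl ?dvdn_gcdr.
move: h; rewrite Gauss_dvdr //.
rewrite /coprime -(eqn_pmul2r g0) muln_gcdl !divnK ?dvdn_gcdl ?dvdn_gcdr //.
by rewrite mul1n.
Qed.

Lemma divisors_pfactor_le p e : prime p -> size (divisors (p ^ e)) <= e.+1.
Proof.
move=> pp.
have -> : e.+1 = size [seq p ^ i | i <- iota 0 e.+1] by rewrite size_map size_iota.
apply: uniq_leq_size; first exact: divisors_uniq.
move=> d; rewrite -dvdn_divisors ?expn_gt0 ?prime_gt0 //.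
move=> /(dvdn_pfactor _ _ pp)[i ie ->]; apply: map_f.
by rewrite mem_iota add0n ltnS ie.
Qed.

Lemma leq_exp_ffact e j : e.+1 ^ j <= (e + j) ^_ j.
Proof.
elim: j => [|j IH]; first by rewrite expn0 ffactn0.
by rewrite addnS ffactnS /= expnS leq_mul // ltnS leq_addr.
Qed.

Lemma leq_bin_exp2 n k : 'C(n, k) <= 2 ^ n.
Proof.
elim: n k => [|n IH] [|k]; rewrite ?bin0 ?bin0n ?expn_gt0 // binS expnS mul2n -addnn.
exact: leq_add.
Qed.

(* For p >= 2 ^ j a prime power factor p ^ e contributes (e + 1) ^ j <= 2 ^ (j * e) <= p ^ e;
   each of the fewer than 2 ^ j smaller primes costs at most the constant K. *)
Lemma divisors_bound j :
  exists2 C, 0 < C & forall n, 0 < n -> size (divisors n) ^ j <= C * n.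
Proof.
pose K := 2 ^ j * j`!.
have K0 : 0 < K by rewrite muln_gt0 expn_gt0 fact_gt0.
have hK e : e.+1 ^ j <= K * 2 ^ e.
  apply: leq_trans (leq_exp_ffact e j) _.
  by rewrite -bin_ffact mulnAC -expnD [j + e]addnC leq_mul2r leq_bin_exp2 orbT.
exists (K ^ 2 ^ j); first by rewrite expn_gt0 K0.
(* Induction on a bound [B] for the primes dividing [n]; the exponent [minn B (2 ^ j)] dominates the
   number of small primes, each charged one factor [K]. *)
suff H B n : 0 < n -> (forall p, prime p -> p %| n -> p < B) ->
    size (divisors n) ^ j <= K ^ minn B (2 ^ j) * n.
  move=> n n0; apply: leq_trans (H n.+1 n n0 _) _.
    by move=> p _ /dvdn_leq; rewrite ltnS; apply.
  by rewrite leq_mul2r leq_pexp2l ?geq_minr ?orbT.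
elim: B n => [|B IH] n n0 hn.
  have -> : n = 1.
    by case: (ltngtP n 1) => // [|/pdiv_prime/hn/(_ (pdiv_dvd n))]; rewrite ?ltn0 //; lia.
  by rewrite /divisors /= exp1n muln1 min0n.
have mono : K ^ minn B (2 ^ j) <= K ^ minn B.+1 (2 ^ j).
  by rewrite leq_pexp2l // leq_min geq_minr andbT geq_min leqnSn.
case pB : (prime B); last first.
  apply: leq_trans (IH n n0 _) _; last by rewrite leq_mul2r mono orbT.
  move=> p pp pn; have := hn p pp pn; rewrite ltnS leq_eqVlt => /orP[/eqP pE|//].
  by rewrite pE pB in pp.
have [m cm nE] := pfactor_coprime pB n0; set e := logn B n in nE.
have m0 : 0 < m by move: n0; rewrite nE muln_gt0 => /andP[].
have hm : size (divisors m) ^ j <= K ^ minn B (2 ^ j) * m.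
  apply: IH => // p pp pm; have := hn p pp; rewrite {1}nE dvdn_mulr // => /(_ isT).
  rewrite ltnS leq_eqVlt => /orP[/eqP pE|//].
  by move: cm; rewrite -pE prime_coprime // pm.
have step : e.+1 ^ j * K ^ minn B (2 ^ j) <= K ^ minn B.+1 (2 ^ j) * B ^ e.
  have [Bj|Bj] := ltnP B (2 ^ j).
    rewrite (minn_idPl Bj) expnS mulnAC leq_mul2r; apply/orP; right.
    apply: leq_trans (hK e) _; rewrite leq_mul2l.
    by case: (e) => [|e']; rewrite ?leqnn ?leq_exp2r ?prime_gt1 ?orbT.
  rewrite (minn_idPr (leqW Bj)) mulnC leq_mul2l; apply/orP; right.
  apply: (@leq_trans ((2 ^ j) ^ e)); last by case: (e) => // e'; rewrite leq_exp2r.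
  by rewrite -expnM mulnC expnM; case: (j) => // j'; rewrite leq_exp2r // ltn_expl.
rewrite [in X in X ^ j]nE.
apply: (@leq_trans ((size (divisors m) * e.+1) ^ j)).
  case: (j) => // j'; rewrite leq_exp2r //.
  apply: leq_trans (divisors_mul_le m0 _) _; first by rewrite expn_gt0 prime_gt0.
  by rewrite leq_mul2l divisors_pfactor_le ?orbT.
rewrite expnMn {1}nE mulnA.
apply: (@leq_trans (K ^ minn B (2 ^ j) * m * e.+1 ^ j)); first by rewrite leq_mul2r hm orbT.
by rewrite mulnAC [leqRHS]mulnAC leq_mul2r [K ^ _ * e.+1 ^ j]mulnC step orbT.
Qed.

(** * Totients and coprimality along arithmetic progressions *)

Lemma leq_totient_dvd m n : 0 < n -> m %| n -> totient m <= totient n.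
Proof.
move=> n0 /dvdnP[q nE]; move: n0; rewrite {n}nE muln_gt0 => /andP[q0 m0].
elim/ltn_ind: q m q0 m0 => q IH m q0 m0.
have [q1|q1] := leqP q 1; first by rewrite (_ : q = 1) ?mul1n //; lia.
rewrite -[q](divnK (pdiv_dvd q)) -mulnA.
have pq := pdiv_prime q1; set p := pdiv q in pq *.
apply: leq_trans (IH (q %/ p) _ (p * m) _ _); last 3 first.
- by rewrite ltn_Pdiv ?prime_gt1.
- by rewrite divn_gt0 ?prime_gt0 // dvdn_leq ?pdiv_dvd.
- by rewrite muln_gt0 prime_gt0.
have [r cr mE] := pfactor_coprime pq m0; rewrite mE; move: (logn p m) => e.
have c i : coprime r (p ^ i) by rewrite coprime_sym coprimeXl.
rewrite mulnCA -expnS !totient_coprime // leq_mul2l; apply/orP; right.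
rewrite [leqRHS]totient_pfactor //=; case: e {mE} => [|e].
  have t1 : totient 1 = 1 by [].
  by rewrite muln1 expn0 t1; have := prime_gt1 pq; lia.
by rewrite totient_pfactor //= leq_mul2l leq_pexp2l ?prime_gt0 ?orbT.
Qed.

(** In n = sum of [totient d] over the divisors d of n, every term is at most [totient n]. With the
    divisor bound this keeps [totient n / n] from being small. *)
Lemma leq_totient_divisors n : 0 < n -> n <= totient n * size (divisors n).
Proof.
move=> n0; rewrite -{1}(sum_totient_dvd n).
apply: (@leq_trans (\sum_(d < n.+1 | d %| n) totient n)).
  by apply: leq_sum => d /leq_totient_dvd ->.
rewrite sum_nat_const mulnC leq_mul2l; apply/orP; right.
rewrite -cardsE; apply: (card_le_divisors (g := val)) => //.
  by move=> d; rewrite inE.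
by move=> d e _ _ /val_inj.
Qed.

(** The upper limit on the right is the ceiling of [(T - t0) / p], and 0 when [T <= t0]. *)
Lemma sum_mod_class (g : nat -> nat) p t0 T : 0 < p -> t0 < p ->
  \sum_(t < T | t %% p == t0) g t = \sum_(s < (T + p.-1 - t0) %/ p) g (t0 + p * s).
Proof.
move=> p0 t0p; elim: T => [|T IH].
  by rewrite big_ord0 divn_small ?big_ord0 //; lia.
rewrite big_mkcond big_ord_recr /= -big_mkcond /= IH.
have -> : T.+1 + p.-1 - t0 = (T + p.-1 - t0).+1 by lia.
rewrite divnS //; have [e|ne] := eqVneq (T %% p) t0.
  have TE := divn_eq T p.
  have -> : (T + p.-1 - t0).+1 = (T %/ p).+1 * p by rewrite -e mulSn; lia.
  rewrite dvdn_mull // add1n big_ord_recr /=; congr (_ + g _).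
  have -> : T + p.-1 - t0 = T %/ p * p + p.-1 by lia.
  by rewrite divnMDl // [p.-1 %/ p]divn_small ?addn0 ?prednK // {1}TE e mulnC addnC.
rewrite addn0 (_ : (p %| _) = false) //; apply/negbTE; apply: contraNN ne => h.
have /dvdnP[c hc] := h; apply/eqP.
have -> : T = c.-1 * p + t0 by case: c hc => [|c] /=; nia.
by rewrite modnMDl modn_small.
Qed.

Lemma linear_root_mod a q p : 0 < p -> coprime q p ->
  exists2 t0, t0 < p & forall t, (p %| a + q * t) = (t %% p == t0).
Proof.
(* [p.-1 * a] represents [- a] modulo [p], so [x] is a multiple of [q] congruent to [- a], and
   [x / q] is the root. *)
move=> p0 cqp; pose x := chinese q p 0 (p.-1 * a).
have hx : x = p.-1 * a %[mod p] by apply: chinese_modr.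
have /dvdnP[s xE] : q %| x by rewrite /dvdn chinese_modl // mod0n.
exists (s %% p) => [|t]; first by rewrite ltn_mod.
have h : p %| a + q * s.
  rewrite mulnC -xE /dvdn -modnDmr hx modnDmr -{1}[a]mul1n -mulnDl add1n prednK //.
  by rewrite modnMr.
have -> : (p %| a + q * t) = (p%:Z %| (q%:Z * (t%:Z - s%:Z))%R)%Z.
  have -> : (q%:Z * (t%:Z - s%:Z) = (a + q * t)%N%:Z - (a + q * s)%N%:Z)%R.
    by rewrite !PoszD !PoszM; ring.
  by rewrite rpredBr.
rewrite Gauss_dvdzr; last by rewrite coprimez_sym.
by rewrite -eqz_mod_dvd !modz_nat eqz_nat.
Qed.

(** Each divisor [d] of [r] yields [d] and [p * d]. This doubling pays for the two uses of the
    induction hypothesis in [coprime_progression_count]. *)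
Lemma divisors_pfactor_ge p e r : prime p -> 0 < e -> 0 < r -> coprime p r ->
  2 * size (divisors r) <= size (divisors (r * p ^ e)).
Proof.
move=> pp e0 r0; rewrite prime_coprime // => /negbTE pr; have p0 := prime_gt0 pp.
rewrite mul2n -addnn -{2}(size_map (muln p)) -size_cat.
apply: uniq_leq_size => [|d].
  rewrite cat_uniq divisors_uniq map_inj_uniq ?divisors_uniq ?andbT /=.
    apply/hasPn => _ /mapP[d _ ->]; apply/negP.
    by rewrite -dvdn_divisors // => /(dvdn_trans (dvdn_mulr _ (dvdnn p))); rewrite pr.
  by move=> x y /eqP; rewrite eqn_pmul2l // => /eqP.
rewrite -dvdn_divisors ?muln_gt0 ?r0 ?expn_gt0 ?p0 // mem_cat => /orP[].
  by rewrite -dvdn_divisors // => /dvdn_mulr.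
move=> /mapP[f]; rewrite -dvdn_divisors // => fr ->.
by rewrite mulnC dvdn_mul // -{1}[p]expn1 dvdn_exp2l.
Qed.

(* Inclusion-exclusion over the primes dividing m, one prime power at a time. *)
Lemma coprime_progression_count (a q m T : nat) : 0 < m -> coprime q m ->
  (`| (\sum_(t < T) coprime (a + q * t) m)%:R - T%:R * ((totient m)%:R / m%:R) |
     <= (size (divisors m))%:R - 1 :> rat)%R.
Proof.
elim/ltn_ind: m a q T => m IH a q T m0 cqm.
have [m1|m1] := leqP m 1.
  have -> : m = 1 by lia.
  rewrite (eq_bigr (fun _ => 1)) => [|t _]; last by rewrite coprimen1.
  by rewrite sum1_card card_ord (_ : totient 1 = 1) // !(mulr1n, divr1, mulr1) !subrr normr0.
have pp := pdiv_prime m1; set p := pdiv m in pp.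
have [r cr mE] := pfactor_coprime pp m0.
have p0 := prime_gt0 pp.
set e := logn p m in mE.
have e0 : 0 < e by rewrite logn_gt0 mem_primes pp m0 pdiv_dvd.
have r0 : 0 < r by move: m0; rewrite mE muln_gt0 => /andP[].
have rm : r < m.
  rewrite mE -{1}[r]muln1 ltn_pmul2l //; case: (e) e0 => // e' _.
  by rewrite -(exp1n e'.+1) ltn_exp2r // prime_gt1.
have cqr : coprime q r by move: cqm; rewrite mE coprimeMr => /andP[].
have cqp : coprime q p.
  by move: cqm; rewrite mE coprimeMr => /andP[_]; rewrite coprime_pexpr.
have [t0 t0p ht0] := linear_root_mod a p0 cqp.
pose T' := (T + p.-1 - t0) %/ p.
(* From the terms coprime to [r], those divisible by [p] are removed; they are the [t] in the class
   [t0] modulo [p], again a progression, of step [q * p]. *)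
have split_count : \sum_(t < T) coprime (a + q * t) r =
    \sum_(t < T) coprime (a + q * t) m +
    \sum_(s < T') coprime ((a + q * t0) + (q * p) * s) r.
  have := sum_mod_class (fun t => coprime (a + q * t) r : nat) T p0 t0p.
  have E s : a + q * t0 + q * p * s = a + q * (t0 + p * s) by ring.
  under [X in _ = X -> _]eq_bigr => s _ do rewrite -E.
  move=> <-; rewrite [X in _ + X]big_mkcond -big_split; apply: eq_bigr => t _ /=.
  rewrite mE coprimeMr coprime_pexpr //.
  rewrite [coprime _ p]coprime_sym (@prime_coprime p) // ht0.
  by case: eqP; case: coprime.
have cqpr : coprime (q * p) r by rewrite coprimeMl cqr.
have IH1 := IH r rm a q T r0 cqr.
have IH2 := IH r rm (a + q * t0) (q * p) T' r0 cqpr.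
(* Two errors [size (divisors r) - 1] and a rounding error of at most 1 from [T'] against [T / p]
   add up to [2 * size (divisors r) - 1]; this explains the [- 1] in the bound. *)
have dm := divisors_pfactor_ge pp e0 r0 cr; rewrite -mE in dm.
have T'1 : T' * p <= T + p by apply: leq_trans (leq_divM _ _) _; lia.
have T'2 : T <= T' * p + p.
  by have := ltn_ceil (T + p.-1 - t0) p0; rewrite -/T' mulSn; lia.
have phi : ((totient m)%:R / m%:R = (totient r)%:R / r%:R * (1 - p%:R^-1) :> rat)%R.
  rewrite mE totient_coprime; last by rewrite coprime_sym coprimeXl.
  rewrite totient_pfactor // -(prednK e0) /= expnS -subn1 !natrM natrB //.
  have : (p%:R != 0 :> rat)%R by rewrite pnatr_eq0 -lt0n.
  have : ((p ^ e.-1)%:R != 0 :> rat)%R by rewrite pnatr_eq0 -lt0n expn_gt0 p0.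
  have : (r%:R != 0 :> rat)%R by rewrite pnatr_eq0 -lt0n.
  by move: (_%:R)%R (_%:R)%R => x y hr hp hpp; field; rewrite hr hp hpp.
have rho0 : (0 <= (totient r)%:R / r%:R :> rat)%R by rewrite divr_ge0 ?ler0n.
have rho1 : ((totient r)%:R / r%:R <= 1 :> rat)%R.
  rewrite ler_pdivrMr ?ltr0n // mul1r ler_nat.
  rewrite totient_count_coprime -[leqRHS]subn0 -[leqRHS]muln1 -sum_nat_const_nat.
  by apply: leq_sum => i _; apply: leq_b1.
have pR : (0 < p%:R :> rat)%R by rewrite ltr0n.
have dT : (`|T%:R / p%:R - T'%:R| <= 1 :> rat)%R.
  move: T'1 T'2; rewrite -!(ler_nat rat) !natrD natrM => T'1 T'2.
  rewrite ler_norml lerBrDr lerBlDr ler_pdivlMr // ler_pdivrMr //.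
  by apply/andP; split; lra.
have dy : (`|(totient r)%:R / r%:R * (T%:R / p%:R - T'%:R)| <= 1 :> rat)%R.
  by rewrite normrM ger0_norm // mulr_ile1.
move: dm; rewrite -(ler_nat rat) natrM => dm.
move: IH1 IH2 dy; rewrite split_count phi natrD.
move: (_ / r%:R)%R => rho; rewrite !ler_norml !mulrBr mulr1.
have -> : (T%:R * (rho * p%:R^-1) = rho * (T%:R / p%:R) :> rat)%R by ring.
by move=> /andP[h1 h2] /andP[h3 h4] /andP[h5 h6]; apply/andP; split; lra.
Qed.

(** * Square roots modulo b and modulo b ^ 2 *)

Lemma even_square_root_mod (b s m k : nat) : odd b -> coprime s b -> m = s ^ 2 %[mod b] ->
  exists a, [/\ a < 2 * b ^ 2, ~~ odd a & a ^ 2 = m ^ k %[mod b ^ 2]].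
Proof.
move=> ob csb ms; have b0 : 0 < b by case: b ob {csb ms}.
(* The added multiple of [b ^ 2] keeps [m' - s ^ 2] from truncating. With [m' = s ^ 2 + c * b], the
   Hensel lift [s + b * t] needs [2 * s * t = c] modulo [b]. At the end the odd [b ^ 2] is added if
   the root has the wrong parity. *)
pose m' := m + b ^ 2 * s ^ 2.
have sm' : s ^ 2 <= m' by apply: leq_trans (leq_addl _ _); rewrite leq_pmull ?expn_gt0 ?b0.
have /dvdnP[c cE] : b %| m' - s ^ 2.
  have E : m' = b * s ^ 2 * b + m by rewrite /m'; ring.
  by rewrite -eqn_mod_dvd // E modnMDl ms.
have c2sb : coprime (2 * s) b by rewrite coprimeMl csb coprime2n ob.
pose x := chinese (2 * s) b 0 c.
have hx : x = c %[mod b] by apply: chinese_modr.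
have /dvdnP[t xE] : 2 * s %| x by rewrite /dvdn chinese_modl // mod0n.
pose r := s + b * t.
have hr : r ^ 2 = m %[mod b ^ 2].
  apply/eqP; rewrite -eqz_nat -!modz_nat eqz_mod_dvd.
  have /dvdzP[y yE] : (b%:Z %| (x%:Z - c%:Z)%R)%Z by rewrite -eqz_mod_dvd !modz_nat hx.
  have cE' : (m%:Z = s%:Z ^+ 2 + c%:Z * b%:Z - b%:Z ^+ 2 * s%:Z ^+ 2)%R.
    have : (m%:Z + b%:Z ^+ 2 * s%:Z ^+ 2 = s%:Z ^+ 2 + c%:Z * b%:Z)%R.
      by move/eqP: cE; rewrite -(eqn_add2r (s ^ 2)) subnK // /m' => /eqP; clear; lia.
    by move=> <-; ring.
  apply/dvdzP; exists (t%:Z ^+ 2 + y + s%:Z ^+ 2)%R; rewrite cE'.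
  have -> : (c%:Z = t%:Z * (2 * s%:Z) - y * b%:Z)%R.
    by rewrite -yE xE; lia.
  rewrite /r; lia.
pose a1 := r ^ k %% b ^ 2.
have ha1 : a1 ^ 2 = m ^ k %[mod b ^ 2].
  by rewrite /a1 modnXm -expnM mulnC expnM -modnXm hr modnXm.
have a1b : a1 < b ^ 2 by rewrite ltn_mod expn_gt0 b0.
case oa : (odd a1); last first.
  by exists a1; split=> //; [apply: leq_trans a1b _; rewrite leq_pmull | rewrite oa].
exists (a1 + b ^ 2); split.
- by rewrite mul2n -addnn ltn_add2r.
- by rewrite oddD oa oddX ob.
by rewrite -modnXm modnDr modnXm.
Qed.

(* The solution in [M, M + 4b) of m = 1 mod 4, m = s ^ 2 mod b. *)
Definition congruent_sqr M b s :=
  M + (chinese 4 b 1 (s ^ 2) + 4 * b * M - M) %% (4 * b).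

Lemma congruent_sqrP M b s : odd b ->
  [/\ M <= congruent_sqr M b s < M + 4 * b, congruent_sqr M b s %% 4 = 1
    & congruent_sqr M b s = s ^ 2 %[mod b]].
Proof.
move=> ob; have b0 : 0 < b by case: b ob.
have c4b : coprime 4 b by rewrite (@coprimeXl 2 2) ?coprime2n.
have E d : d %| 4 * b -> congruent_sqr M b s = chinese 4 b 1 (s ^ 2) %[mod d].
  move=> dd; rewrite /congruent_sqr -modnDmr modn_dvdm // modnDmr addnC subnK.
    have /dvdnP[c ->] := dd; rewrite mulnAC addnC modnMDl //.
  by apply: leq_trans (leq_addl _ _); rewrite leq_pmull // muln_gt0.
split.
- by rewrite leq_addr ltn_add2l ltn_mod muln_gt0.
- by rewrite E ?dvdn_mulr // chinese_modl.
by rewrite E ?dvdn_mull // chinese_modr.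
Qed.

(** * Squarefree parts *)

Definition sqpart x := \max_(f < x.+1 | f ^ 2 %| x) f.
(** The squarefree part of a positive [x]. *)
Definition core x := x %/ sqpart x ^ 2.

Lemma leq_sqpart x f : 0 < x -> f ^ 2 %| x -> f <= sqpart x.
Proof.
move=> x0 fx; have fx' : f < x.+1.
  rewrite ltnS; apply: leq_trans (dvdn_leq x0 fx).
  by rewrite -mulnn; case: (f) => // f'; rewrite leq_pmulr.
exact: (@leq_bigmax_cond _ (fun i : 'I_x.+1 => i ^ 2 %| x) (fun i : 'I_x.+1 => i : nat)
  (Ordinal fx')).
Qed.

Lemma sqpart_dvd x : 0 < x -> sqpart x ^ 2 %| x.
Proof.
move=> x0; rewrite /sqpart.
have h : 0 < #|[pred f : 'I_x.+1 | f ^ 2 %| x]|.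
  by apply/card_gt0P; exists (Ordinal (x0 : 1 < x.+1)); rewrite inE /= exp1n dvd1n.
have [i hi ->] := eq_bigmax_cond (fun f : 'I_x.+1 => f : nat) h.
by move: hi; rewrite inE.
Qed.

Lemma core_sqpart x : 0 < x -> x = core x * sqpart x ^ 2.
Proof. by move=> x0; rewrite divnK ?sqpart_dvd. Qed.

Lemma core_squarefree x : 0 < x -> squarefree (core x).
Proof.
move=> x0 f fc; have E := core_sqpart x0.
have s0 : 0 < sqpart x.
  by apply: leq_sqpart => //; rewrite exp1n dvd1n.
have : f * sqpart x <= sqpart x.
  by apply: leq_sqpart => //; rewrite [X in _ %| X]E expnMn dvdn_mul.
have f0 : 0 < f.
  by case: f fc => // /dvdnP[c]; rewrite muln0 => c0; move: x0; rewrite E c0 mul0n.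
by rewrite -{2}[sqpart x]mul1n leq_pmul2r // => f1; apply/eqP; rewrite eqn_leq f1.
Qed.

(** After division by [gcdn b F], with [F = sqpart x], the squares of the two quotients are coprime,
    so that of [b] divides the squarefree [core x] and the quotient is 1. *)
Lemma dvdn_sqpart x b : 0 < x -> b ^ 2 %| x -> b %| sqpart x.
Proof.
move=> x0 bx; have E := core_sqpart x0; set F := sqpart x in E *.
have F0 : 0 < F by apply: leq_sqpart => //; rewrite exp1n dvd1n.
have g0 : 0 < gcdn b F by rewrite gcdn_gt0 F0 orbT.
have cop : coprime (b %/ gcdn b F) (F %/ gcdn b F).
  by rewrite /coprime -(eqn_pmul2r g0) muln_gcdl !divnK ?dvdn_gcdl ?dvdn_gcdr ?mul1n.
have : (b %/ gcdn b F) ^ 2 %| core x.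
  have c2 : coprime ((b %/ gcdn b F) ^ 2) ((F %/ gcdn b F) ^ 2).
    by rewrite coprimeXl // coprimeXr.
  rewrite -(Gauss_dvdl _ c2).
  have g20 : 0 < gcdn b F ^ 2 by rewrite expn_gt0 g0.
  rewrite -(dvdn_pmul2r g20) -mulnA -!expnMn.
  by rewrite (divnK (dvdn_gcdl b F)) (divnK (dvdn_gcdr b F)) -E.
move=> /(core_squarefree x0) bg.
by rewrite -[b](divnK (dvdn_gcdl b F)) bg mul1n dvdn_gcdr.
Qed.

(** Telescoping of 1 / w ^ 2 <= 1 / (w - 1) - 1 / w, from w = [W0.+2] on. *)
Lemma sum_div_sqr (A W0 n : nat) :
  \sum_(w < n) A %/ (W0.+2 + w) ^ 2 * W0.+1 <= A.
Proof.
suff H : ((\sum_(w < n) A %/ (W0.+2 + w) ^ 2)%:R <=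
    A%:R * (W0.+1%:R^-1 - (W0.+1 + n)%:R^-1) :> rat)%R.
  rewrite -big_distrl /= -(ler_nat rat) natrM.
  have w0 : (0 < W0.+1%:R :> rat)%R by rewrite ltr0n.
  rewrite -ler_pdivlMr //; apply: le_trans H _.
  by rewrite ler_wpM2l // lerBlDr lerDl invr_ge0 ler0n.
elim: n => [|n IH]; first by rewrite big_ord0 addn0 subrr mulr0.
rewrite big_ord_recr /= natrD; apply: le_trans (lerD IH (_ : _ <= A%:R / (W0.+2 + n)%:R ^+ 2)%R) _.
  rewrite ler_pdivlMr ?exprn_gt0 ?ltr0n // -natrX -natrM ler_nat.
  exact: leq_divM.
have E1 : ((W0.+2 + n)%:R = (W0.+1 + n)%:R + 1 :> rat)%R by rewrite -natr1 addSn.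
have E2 : ((W0.+1 + n.+1)%:R = (W0.+1 + n)%:R + 1 :> rat)%R by rewrite addnS -natr1.
rewrite E1 E2 -mulrDr ler_wpM2l ?ler0n //.
have : (0 < (W0.+1 + n)%:R :> rat)%R by rewrite ltr0n.
move: (_%:R)%R (W0.+1%:R^-1)%R => x y x0.
have x1 : (0 < x + 1)%R by lra.
have -> : (y - x^-1 + (x + 1) ^- 2 = y - (x + 1)^-1 - (x * (x + 1) ^+ 2)^-1)%R.
  by field; rewrite !gt_eqF.
rewrite gerBl invr_ge0 mulr_ge0 ?exprn_ge0 //; lra.
Qed.

(* Representations m ^ k = a ^ 2 + n f ^ 2 are determined by a / f modulo m ^ k. *)
Lemma card_core_fiber (k m A n : nat) : odd m ->  0 < n ->
  #|[set a : 'I_A | [&& coprime a m, a ^ 2 < m ^ k & core (m ^ k - a ^ 2) == n]]|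
    <= size (divisors (m ^ k)).
Proof.
move=> om n0; set S := [set a : 'I_A | _].
pose F (a : 'I_A) := sqpart (m ^ k - a ^ 2).
have SP a : a \in S -> [/\ coprime a m, 0 < F a & m ^ k = a ^ 2 + n * F a ^ 2].
  rewrite inE => /and3P[cam am /eqP nE].
  have x0 : 0 < m ^ k - a ^ 2 by rewrite subn_gt0.
  split=> //; first by apply: leq_sqpart; rewrite // exp1n dvd1n.
  by rewrite -{1}nE -core_sqpart // subnKC // ltnW.
apply: (@card_square_proportional _ _ S (fun a => Posz a) (fun a => Posz (F a))).
- by rewrite oddX om orbT.
- move=> a /SP[cam F0 E]; rewrite !coprimezE /= coprimeXr //=.
  have [->|k0] := posnP k; first by rewrite expn0 coprimen1.
  rewrite coprimeXr // /coprime -dvdn1; set g := gcdn _ _.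
  have gm : g %| m by apply: dvdn_gcdr.
  have : g %| a ^ 2.
    have : g %| a ^ 2 + n * F a ^ 2 by rewrite -E -(prednK k0) expnS dvdn_mulr.
    by rewrite dvdn_addl // -mulnn mulnA dvdn_mull // dvdn_gcdl.
  have : coprime (a ^ 2) g by rewrite coprimeXl // (coprime_dvdr gm).
  by rewrite /coprime gcdnC => /eqP + /gcdn_idPl; move=> -> <-.
- move=> a c /SP[_ _ Ea] /SP[_ _ Ec]; apply/dvdzP.
  exists ((F c)%:Z ^+ 2 - (F a)%:Z ^+ 2)%R.
  have Eaz : ((m ^ k)%N%:Z = (a : nat)%:Z ^+ 2 + n%:Z * (F a)%:Z ^+ 2)%R by rewrite Ea; clear; lia.
  have Ecz : ((m ^ k)%N%:Z = (c : nat)%:Z ^+ 2 + n%:Z * (F c)%:Z ^+ 2)%R by rewrite Ec; clear; lia.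
  transitivity ((F c)%:Z ^+ 2 * (m ^ k)%N%:Z - (F a)%:Z ^+ 2 * (m ^ k)%N%:Z)%R; last by ring.
  by rewrite {1}Eaz Ecz; ring.
move=> a c aS cS h; apply/val_inj => /=.
have cop_F x : x \in S -> coprime x (F x).
  move=> xS; have [cx _ Ex] := SP x xS.
  have cxm : coprime x (m ^ k) by rewrite coprimeXr.
  rewrite /coprime -dvdn1 -(eqP cxm) dvdn_gcd dvdn_gcdl Ex dvdn_add //.
    by rewrite -mulnn dvdn_mull // dvdn_gcdl.
  by rewrite -mulnn mulnA dvdn_mull // dvdn_gcdr.
(* Both sides of [a * F c = c * F a] modulo [m ^ k] lie below the modulus, so the congruence is an
   equality; as [a] is coprime to [F a] and [c] to [F c], each of [a] and [c] divides the other. *)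
have small x y : x \in S -> y \in S -> x * F y < m ^ k.
  move=> xS yS; have [_ Fy Ey] := SP y yS.
  have x2 : x ^ 2 < m ^ k by move: xS; rewrite inE => /and3P[].
  have F2 : F y ^ 2 <= m ^ k.
    by rewrite Ey; apply: leq_trans (leq_addl _ _); rewrite leq_pmull.
  rewrite -ltn_sqr expnMn -[ltnRHS]mulnn; apply: leq_ltn_trans (_ : x ^ 2 * m ^ k < _).
    by rewrite leq_mul2l F2 orbT.
  by rewrite ltn_pmul2r // expn_gt0; move: om; case: (m).
have E : a * F c = c * F a.
  apply/eqP; move: h; rewrite -!PoszM -eqz_mod_dvd !modz_nat !modn_small //; exact: small.
apply/eqP; rewrite eqn_dvd; apply/andP; split.
  by rewrite -(Gauss_dvdl _ (cop_F a aS)) -E dvdn_mulr.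
by rewrite -(Gauss_dvdl _ (cop_F c cS)) E dvdn_mulr.
Qed.

(* Each residue class modulo w ^ 2 meets [0, A) in at most A / w ^ 2 + 1 points. *)
Lemma card_square_dvd (k m A w : nat) : 0 < k -> odd w ->
  #|[set a : 'I_A | [&& coprime a m, a ^ 2 <= m ^ k & w ^ 2 %| m ^ k - a ^ 2]]|
    <= (A %/ w ^ 2).+1 * size (divisors (w ^ 2)).
Proof.
move=> k0 ow; set S := [set a : 'I_A | _].
have w0 : 0 < w ^ 2 by rewrite expn_gt0; case: (w) ow.
pose g (a : 'I_A) : 'I_(w ^ 2) := Ordinal (ltn_pmod a w0).
have SP a : a \in S -> [/\ coprime a m, a ^ 2 <= m ^ k & m ^ k = a ^ 2 %[mod w ^ 2]].
  by rewrite inE => /and3P[ca am wa]; split=> //; apply/eqP; rewrite eqn_mod_dvd.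
have cop_w a : a \in S -> coprime a (w ^ 2).
  move=> aS; have [ca am aw] := SP a aS.
  rewrite coprimeXr // /coprime -dvdn1.
  have h : gcdn a w %| m ^ k.
    rewrite -(subnK am) dvdn_add //; last by rewrite -mulnn dvdn_mull // dvdn_gcdl.
    have /andP[/andP[_ _]] : (coprime a m && (a ^ 2 <= m ^ k)) && (w ^ 2 %| m ^ k - a ^ 2).
      by move: aS; rewrite inE andbA.
    by apply: dvdn_trans; rewrite -mulnn dvdn_mull // dvdn_gcdr.
  have cxm : coprime a (m ^ k) by rewrite coprimeXr.
  by rewrite -(eqP cxm) dvdn_gcd dvdn_gcdl h.
apply: leq_trans (card_le_fibers (f := g) (c := (A %/ w ^ 2).+1) _) _.
  move=> y; rewrite -[X in _ <= X]card_ord.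
  have lt_q (a : 'I_A) : a %/ w ^ 2 < (A %/ w ^ 2).+1 by rewrite ltnS leq_div2r // ltnW.
  pose h (a : 'I_A) : 'I_(A %/ w ^ 2).+1 := Ordinal (lt_q a).
  apply: (@leq_card_in _ _ h) => a b.
  rewrite !inE => /andP[_ /eqP <-] /andP[_ /eqP[eg]] [eh]; apply/val_inj => /=.
  by rewrite (divn_eq a (w ^ 2)) (divn_eq b (w ^ 2)) eg eh.
rewrite leq_mul2l; apply/orP; right.
apply: (@card_square_proportional _ _ _ (fun x : 'I_(w ^ 2) => Posz x) (fun => 1%R)).
- by rewrite oddX ow.
- move=> _ /imsetP[a aS ->] /=; rewrite !coprimezE /= coprime1n andbT.
  by rewrite /coprime gcdnC gcdn_modr gcdnC; apply: cop_w.
- move=> _ _ /imsetP[a aS ->] /imsetP[b bS ->] /=.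
  rewrite !mulr1 -eqz_mod_dvd -!natz -!natrX !natz !modz_nat !modnXm.
  by have [_ _ <-] := SP a aS; have [_ _ <-] := SP b bS.
move=> _ _ /imsetP[a aS ->] /imsetP[b bS ->] /=.
rewrite !mulr1 -eqz_mod_dvd !modz_nat !modn_mod => /eqP[e].
by apply/val_inj.
Qed.

(** * Counting pairs (m, a) *)

Lemma card_sum_fibers (T U : finType) (E : {set T * U}) :
  #|E| = \sum_m #|[set a | (m, a) \in E]|.
Proof.
rewrite -sum1_card; under [RHS]eq_bigr => m _ do rewrite -sum1_card.
rewrite pair_big_dep; apply: eq_bigl => -[m a] /=.
by rewrite inE.
Qed.

(** Here [F] counts the terms coprime to [m] among [T] terms of a progression, [p] is the totient of
    [m], [d] its number of divisors and [D] a uniform bound for [d]. *)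
Lemma sieve_arith (R : realFieldType) (T F D m p d : R) : (0 < m -> 0 <= T -> 0 < D ->
  - (d - 1) <= F - T * (p / m) -> d <= D -> m <= p * D -> T <= F * D + D * D)%R.
Proof.
move=> m0 T0 D0 h1 h2 h3.
have h4 : (T <= T * (p / m) * D)%R.
  by rewrite -mulrA -{1}[T]mulr1 ler_wpM2l // mulrAC ler_pdivlMr // mul1r.
have h5 : (T * (p / m) * D <= (F + D) * D)%R by apply: ler_wpM2r; [exact: ltW|lra].
lra.
Qed.

Lemma double_bounds Z i : i < Z -> 2 * Z <= (Z + i).*2.+1 <= 2 ^ 2 * Z.
Proof. lia. Qed.

Section Count.
Variables (t k z Dm : nat).
Hypotheses (tE : t = 2) (k5 : 5 <= k) (z0 : 0 < z).
(* Like t = 2, these are variables with defining equations, lest constants such as 2 ^ 30 be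
   evaluated in unary. *)
Variables (q c Mb Ab T : nat).
(** [q] carries the dependence on [k]: m ^ k has size [q ^ 2 * z ^ 50] and a has size
    [q * z ^ 25 = z ^ (5 * k)]. [T] is the length of a progression of step 2 b ^ 2 that fits below
    [Ab] for b up to [t ^ 4 * z ^ 10]. *)
Hypotheses (qE : q = z ^ (5 * (k - 5))) (cE : c = t ^ (7 * k)).
Hypotheses (MbE : Mb = t ^ 7 * z ^ 10) (AbE : Ab = t ^ 14 * (q * z ^ 25)).
Hypothesis TE : T = t ^ 5 * (q * z ^ 5).
Hypothesis hD : forall x, 0 < x -> x <= Mb ^ k -> size (divisors x) <= Dm.
Hypothesis hz : t ^ 9 * c * Dm ^ 6 <= z.

(** Odd numbers of size z ^ 6, and below of size z ^ 4. They play the roles of p and r; that a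
    number may be divisible by several of them costs only factors [Dm]. *)
Definition pfac i := (z ^ 6 + i).*2.+1.
Definition rfac j := (z ^ 4 + j).*2.+1.

(** The lower bound on [m] keeps a ^ 2 well below m ^ k. With [m] congruent to 1 modulo 4 and [a]
    even, m ^ k - a ^ 2 is odd and its squarefree part is 1 modulo 4. *)
Definition admissible (m a : nat) := [&& t ^ 6 * z ^ 10 <= m, m %% 4 == 1, ~~ odd a & coprime a m].

Definition dvd_pairs (b : nat) : {set 'I_Mb * 'I_Ab} :=
  [set x : 'I_Mb * 'I_Ab | admissible x.1 x.2 && (b ^ 2 %| x.1 ^ k - x.2 ^ 2)].

Definition pairs : {set 'I_Mb * 'I_Ab} :=
  [set x : 'I_Mb * 'I_Ab |
    [exists i : 'I_(z ^ 6), [exists j : 'I_(z ^ 4), x \in dvd_pairs (pfac i * rfac j)]]].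

Let t0 : 0 < t. Proof. by rewrite tE. Qed.
Let t1 : 1 < t. Proof. by rewrite tE. Qed.
Let q0 : 0 < q. Proof. by rewrite qE expn_gt0 z0. Qed.
Let Dm0 : 0 < Dm.
Proof.
by apply: leq_trans (hD (isT : 0 < 1) _); rewrite // expn_gt0 MbE muln_gt0 !expn_gt0 t0 z0.
Qed.

Let z10k : (z ^ 10) ^ k = q ^ 2 * z ^ 50.
Proof. by rewrite qE -!expnM -expnD; congr (z ^ _); move: k5; clear; lia. Qed.

Let pow_upper m : m < Mb -> m ^ k <= c * (q ^ 2 * z ^ 50).
Proof.
move=> mM; rewrite -z10k cE expnM -expnMn -MbE leq_exp2r; first exact: ltnW.
by apply: leq_trans k5.
Qed.

Let pow_lower m : t ^ 6 * z ^ 10 <= m -> t ^ 30 * (q ^ 2 * z ^ 50) <= m ^ k.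
Proof.
move=> mM; have k0 : 0 < k by apply: leq_trans k5.
apply: (@leq_trans ((t ^ 6 * z ^ 10) ^ k)); last by rewrite leq_exp2r.
rewrite expnMn z10k leq_mul2r -expnM (_ : 30 = 6 * 5) //.
by rewrite leq_exp2l // leq_pmul2l // k5 orbT.
Qed.

(** The constants match here: [t ^ 30 = t ^ 2 * (t ^ 14) ^ 2]. Hence m ^ k - a ^ 2 keeps the size of
    m ^ k. *)
Let sqr_upper m a : t ^ 6 * z ^ 10 <= m -> a < Ab -> t ^ 2 * a ^ 2 <= m ^ k.
Proof.
move=> /pow_lower mM aA; apply: leq_trans mM.
have -> : t ^ 30 * (q ^ 2 * z ^ 50) = t ^ 2 * Ab ^ 2 by rewrite AbE; ring.
by rewrite leq_mul2l leq_sqr ltnW ?orbT.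
Qed.

Let sqr_lt m a : t ^ 6 * z ^ 10 <= m -> a < Ab -> a ^ 2 < m ^ k.
Proof.
move=> mM aA; have := sqr_upper mM aA.
have mk : 0 < m ^ k.
  by apply: leq_trans (pow_lower mM); rewrite muln_gt0 expn_gt0 t0 muln_gt0 !expn_gt0 q0 z0.
by rewrite tE; move: mk; move: (m ^ k) (a ^ 2) => x y; clear; lia.
Qed.

Let leq_Mb m : m < Mb -> m <= Mb ^ k.
Proof.
move=> mM; apply: leq_trans (ltnW mM) _; rewrite -{1}[Mb]expn1 leq_pexp2l //.
  by rewrite MbE muln_gt0 !expn_gt0 t0 z0.
by apply: leq_trans k5.
Qed.

(* For fixed m, a runs through a progression modulo 2 b ^ 2. *)
Lemma dvd_pairs_fiber (b s : nat) (m : 'I_Mb) :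
  odd b -> b <= t ^ 4 * z ^ 10 -> coprime s b ->
  t ^ 6 * z ^ 10 <= m -> m %% 4 = 1 -> m = s ^ 2 %[mod b] ->
  T <= 2 * Dm * #|[set a | (m, a) \in dvd_pairs b]|.
Proof.
move=> ob bz csb mM m4 ms.
have b0 : 0 < b by case: (b) ob.
have [a0 [a0b a0e a0m]] := even_square_root_mod k ob csb ms.
have om : odd m by rewrite (divn_eq m 4) m4 oddD oddM andbF.
have cbm : coprime m b by rewrite /coprime gcdnC -gcdn_modr ms gcdn_modr gcdnC; exact: coprimeXl.
have cqm : coprime (2 * b ^ 2) m.
  by rewrite coprimeMl coprime2n om coprimeXl // coprime_sym.
have m0 : 0 < m by move: om; case: (m : nat).
have := coprime_progression_count a0 T m0 cqm.
set F := \sum_(_ < _) _.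
have dm : size (divisors m) <= Dm by apply: hD => //; exact: leq_Mb.
have hphi : m <= totient m * Dm.
  by apply: leq_trans (leq_totient_divisors m0) _; rewrite leq_mul2l dm orbT.
move=> hF.
have {hF} TF : T <= F * Dm + Dm ^ 2.
  move: hF dm hphi; rewrite -!(ler_nat rat) natrD !natrM ler_norml.
  have mr : (0 < m%:R :> rat)%R by rewrite ltr0n.
  have Tr : (0 <= T%:R :> rat)%R by rewrite ler0n.
  have Dr : (0 < Dm%:R :> rat)%R by rewrite ltr0n.
  by move=> /andP[h1 _] h2 h3; apply: sieve_arith h1 h2 h3.
(* This absorbs the sieve error [Dm ^ 2] into half of [T]. *)
have D2T : 2 * Dm ^ 2 <= T.
  apply: (@leq_trans z).
    apply: leq_trans hz; have -> : t ^ 9 * c * Dm ^ 6 = t * (t ^ 8 * c * Dm ^ 4) * Dm ^ 2 by ring.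
    apply: leq_mul => //; apply: (@leq_trans t); first by rewrite tE.
    by rewrite leq_pmulr // muln_gt0 expn_gt0 Dm0 andbT muln_gt0 cE !expn_gt0 t0.
  rewrite TE (_ : z ^ 5 = z * z ^ 4); last by ring.
  rewrite (_ : t ^ 5 * (q * (z * z ^ 4)) = t ^ 5 * (q * z ^ 4) * z); last by ring.
  by rewrite leq_pmull // muln_gt0 expn_gt0 t0 muln_gt0 expn_gt0 q0 z0.
have FE : F <= #|[set a | (m, a) \in dvd_pairs b]|.
  have lt_A (i : 'I_T) : a0 + 2 * b ^ 2 * i < Ab.
    apply: (@leq_trans (2 * b ^ 2 * T)).
      apply: (@leq_trans (2 * b ^ 2 * i.+1)); last by rewrite leq_mul2l ltn_ord orbT.
      by rewrite mulnS ltn_add2r.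
    have -> : Ab = t * (t ^ 4 * z ^ 10) ^ 2 * T by rewrite AbE TE; ring.
    by apply: leq_mul => //; apply: leq_mul; rewrite ?leq_sqr // tE.
  pose g (i : 'I_T) : 'I_Ab := Ordinal (lt_A i).
  have ginj : injective g.
    move=> i j [/eqP]; rewrite eqn_add2l eqn_pmul2l ?muln_gt0 ?expn_gt0 ?b0 // => /eqP h.
    exact/val_inj.
  have -> : F = #|[set i : 'I_T | coprime (a0 + 2 * b ^ 2 * i) m]|.
    rewrite -sum1_card big_mkcond; apply: eq_bigr => i _; rewrite inE.
    by case: coprime.
  rewrite -(card_imset _ ginj); apply: subset_leq_card; apply/subsetP => x /imsetP[i].
  rewrite !inE /admissible /= => ci ->; rewrite mM m4 eqxx ci /=.
  rewrite oddD !oddM /= negb_add (negbTE a0e) /= -eqn_mod_dvd; last first.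
    by apply/ltnW/sqr_lt.
  apply/eqP; rewrite -a0m -modnXm -[in RHS]modnXm; congr ((_ ^ _) %% _).
  by rewrite mulnAC -modnDmr modnMl addn0.
move: TF D2T FE; rewrite -mulnA; move: (#|_|) => x TF D2T FE.
have : F * Dm <= Dm * x by rewrite mulnC leq_mul2l FE orbT.
move: TF D2T; move: (F * Dm) (Dm * x) (Dm ^ 2) => u v w; clear; lia.
Qed.

(** Each unit s modulo [b] gives an m congruent to s ^ 2. An m arises from at most [Dm] units, so at
    least b / Dm ^ 2 values of m occur, each with at least T / (2 Dm) values of a. *)
Lemma card_dvd_pairs_ge (b : nat) :
  odd b -> b <= t ^ 4 * z ^ 10 -> b * T <= 2 * Dm ^ 3 * #|dvd_pairs b|.
Proof.
move=> ob bz; have b0 : 0 < b by case: (b) ob.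
pose g s := congruent_sqr (t ^ 6 * z ^ 10) b s.
have gP s := congruent_sqrP (t ^ 6 * z ^ 10) s ob.
have lt_g s : g s < Mb.
  have [/andP[_ +] _ _] := gP s; move/leq_trans; apply.
  have -> : Mb = t ^ 6 * z ^ 10 * t by rewrite MbE; ring.
  rewrite {3}tE muln2 -addnn leq_add2l.
  have -> : t ^ 6 * z ^ 10 = t ^ 2 * (t ^ 4 * z ^ 10) by ring.
  by rewrite {1}tE leq_mul.
pose G (s : 'I_b) : 'I_Mb := Ordinal (lt_g s).
pose units : {set 'I_b} := [set s : 'I_b | coprime s b].
have card_units : #|units| = totient b.
  rewrite totient_count_coprime big_mkord -sum1_card big_mkcond; apply: eq_bigr => s _.
  by rewrite inE coprime_sym; case: coprime.
have bM : b < Mb.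
  by apply: leq_ltn_trans bz _; rewrite MbE ltn_pmul2r ?ltn_exp2l // expn_gt0 z0.
have db : size (divisors b) <= Dm by apply: hD => //; exact: leq_Mb.
have b_phi : b <= totient b * Dm.
  by apply: leq_trans (leq_totient_divisors b0) _; rewrite leq_mul2l db orbT.
have phi_S : totient b <= Dm * #|G @: units|.
  rewrite -card_units; apply: card_le_fibers => y; apply: leq_trans db.
  have sq_y (s : 'I_b) : G s = y -> s ^ 2 = y %[mod b] by move=> <- /=; have [_ _ ->] := gP s.
  apply: (@card_square_proportional _ _ _ (fun s : 'I_b => Posz s) (fun => 1%R)) => //.
  - by move=> s; rewrite !inE => /andP[cs _]; rewrite !coprimezE /= cs coprime1n.
  - move=> s s'; rewrite !inE => /andP[_ /eqP/sq_y e] /andP[_ /eqP/sq_y e'].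
    by rewrite !mulr1 -eqz_mod_dvd -!natz -!natrX !natz !modz_nat e e'.
  move=> s s' _ _; rewrite !mulr1 -eqz_mod_dvd !modz_nat !modn_small // => /eqP[e].
  exact/val_inj.
have fib m : m \in G @: units -> T <= 2 * Dm * #|[set a | (m, a) \in dvd_pairs b]|.
  move=> /imsetP[s]; rewrite inE => cs ->.
  have [/andP[gM _] g4 gs] := gP s.
  exact: (@dvd_pairs_fiber b s (G s) ob bz cs gM g4 gs).
have ST : #|G @: units| * T <= 2 * Dm * #|dvd_pairs b|.
  rewrite card_sum_fibers -sum_nat_const big_distrr /=.
  apply: leq_trans (leq_sum _ fib) _.
  by rewrite [leqRHS](bigID (mem (G @: units))) leq_addr.
apply: leq_trans (_ : Dm ^ 2 * #|G @: units| * T <= _).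
  rewrite leq_mul2r; apply/orP; right; apply: leq_trans b_phi _.
  rewrite (_ : Dm ^ 2 * _ = Dm * #|G @: units| * Dm); last by ring.
  by rewrite leq_mul2r phi_S orbT.
rewrite -mulnA (_ : 2 * Dm ^ 3 * _ = Dm ^ 2 * (2 * Dm * #|dvd_pairs b|)); last by ring.
by rewrite leq_mul2l ST orbT.
Qed.

Let card_dvd_factors (L N : nat) (h : 'I_L -> nat) : injective h -> 0 < N -> N <= Mb ^ k ->
  #|[set i | h i %| N]| <= Dm.
Proof.
move=> hinj N0 NM; apply: leq_trans (hD N0 NM).
apply: (card_le_divisors (g := h)) => // [i|i j _ _]; first by rewrite inE.
exact: hinj.
Qed.

Lemma dvd_pairsP b x : x \in dvd_pairs b ->
  [/\ t ^ 6 * z ^ 10 <= x.1, x.1 %% 4 = 1, ~~ odd x.2, coprime x.2 x.1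
    & b ^ 2 %| x.1 ^ k - x.2 ^ 2].
Proof. by rewrite inE => /andP[/and4P[? /eqP ? ? ?] ?]. Qed.

(** Double counting: for a given pair, at most [Dm] of the [pfac i] and at most [Dm] of the [rfac j]
    divide m ^ k - a ^ 2. *)
Lemma sum_dvd_pairs_le :
  \sum_(i < z ^ 6) \sum_(j < z ^ 4) #|dvd_pairs (pfac i * rfac j)| <= Dm ^ 2 * #|pairs|.
Proof.
rewrite pair_big /=.
under eq_bigr => ij _ do rewrite -sum1_card big_mkcond /=.
rewrite exchange_big /= mulnC -sum_nat_const [leqRHS]big_mkcond.
apply: leq_sum => x _; rewrite -big_mkcond sum1dep_card.
case: ifP => [xp|/negbT xp]; last first.
  rewrite leqn0 cards_eq0; apply: contraNT xp => /set0Pn[[i j]].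
  by rewrite inE => xij; rewrite inE; apply/existsP; exists i; apply/existsP; exists j.
have [xM N0] : t ^ 6 * z ^ 10 <= x.1 /\ 0 < x.1 ^ k - x.2 ^ 2.
  move: xp; rewrite inE => /existsP[i /existsP[j /dvd_pairsP[xM _ _ _ _]]].
  by split=> //; rewrite subn_gt0 sqr_lt.
have NM : x.1 ^ k - x.2 ^ 2 <= Mb ^ k.
  apply: leq_trans (leq_subr _ _) _; rewrite leq_exp2r ?(leq_trans _ k5) //.
  exact: ltnW.
apply: (@leq_trans #|setX [set i : 'I_(z ^ 6) | pfac i %| x.1 ^ k - x.2 ^ 2]
                          [set j : 'I_(z ^ 4) | rfac j %| x.1 ^ k - x.2 ^ 2]|).
  apply: subset_leq_card; apply/subsetP => -[i j]; rewrite !inE /= => /andP[_ d].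
  by rewrite !(dvdn_trans _ d) // -mulnn;
    [rewrite mulnA dvdn_mull // dvdn_mull|rewrite -mulnA dvdn_mulr // dvdn_mulr].
rewrite cardsX -mulnn; apply: leq_mul.
  apply: card_dvd_factors N0 NM => i j; rewrite /pfac => -[/double_inj/eqP].
  by rewrite eqn_add2l => /eqP/val_inj.
apply: card_dvd_factors N0 NM => i j; rewrite /rfac => -[/double_inj/eqP].
by rewrite eqn_add2l => /eqP/val_inj.
Qed.

Lemma pfac_bounds (i : 'I_(z ^ 6)) : t * z ^ 6 <= pfac i <= t ^ 2 * z ^ 6.
Proof.
by rewrite tE; apply: double_bounds.
Qed.

Lemma rfac_bounds (j : 'I_(z ^ 4)) : t * z ^ 4 <= rfac j <= t ^ 2 * z ^ 4.
Proof.
by rewrite tE; apply: double_bounds.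
Qed.

(** There are z ^ 10 choices of (i, j), each with b of size z ^ 10 and [T] of size [q * z ^ 5]. The
    losses are [Dm ^ 3] for one b and [Dm ^ 2] for multiplicity. *)
Lemma card_pairs_ge : t ^ 6 * (q * z ^ 25) <= Dm ^ 5 * #|pairs|.
Proof.
have lower (i : 'I_(z ^ 6)) (j : 'I_(z ^ 4)) :
    t ^ 2 * z ^ 10 * T <= 2 * Dm ^ 3 * #|dvd_pairs (pfac i * rfac j)|.
  have /andP[p1 p2] := pfac_bounds i; have /andP[r1 r2] := rfac_bounds j.
  apply: leq_trans (card_dvd_pairs_ge _ _).
  - rewrite leq_mul2r; apply/orP; right.
    have -> : t ^ 2 * z ^ 10 = (t * z ^ 6) * (t * z ^ 4) by ring.
    exact: leq_mul.
  - by rewrite oddM /= !odd_double.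
  have -> : t ^ 4 * z ^ 10 = (t ^ 2 * z ^ 6) * (t ^ 2 * z ^ 4) by ring.
  exact: leq_mul.
have : \sum_(i < z ^ 6) \sum_(j < z ^ 4) (t ^ 2 * z ^ 10 * T) <= 2 * Dm ^ 3 * (Dm ^ 2 * #|pairs|).
  apply: leq_trans (leq_mul (leqnn _) sum_dvd_pairs_le).
  rewrite big_distrr; apply: leq_sum => i _; rewrite big_distrr; apply: leq_sum => j _.
  exact: lower.
rewrite !sum_nat_const !card_ord TE => h.
rewrite -(leq_pmul2l t0); apply: leq_trans (_ : 2 * Dm ^ 3 * (Dm ^ 2 * #|pairs|) <= _).
  apply: leq_trans h; have -> : z ^ 6 * (z ^ 4 * (t ^ 2 * z ^ 10 * (t ^ 5 * (q * z ^ 5)))) =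
    t * (t ^ 6 * (q * z ^ 25)) by ring.
  exact: leqnn.
by rewrite tE (_ : 2 * Dm ^ 3 * _ = 2 * (Dm ^ 5 * #|pairs|)) //; ring.
Qed.

(** * Discarding the pairs whose squarefree part is too small *)

Definition power_gap (x : 'I_Mb * 'I_Ab) := x.1 ^ k - x.2 ^ 2.

Lemma pairsP x : x \in pairs ->
  [/\ t ^ 6 * z ^ 10 <= x.1, x.1 %% 4 = 1, ~~ odd x.2, coprime x.2 x.1 &
    exists i : 'I_(z ^ 6), exists j : 'I_(z ^ 4), (pfac i * rfac j) ^ 2 %| power_gap x].
Proof.
rewrite inE => /existsP[i /existsP[j /dvd_pairsP[? ? ? ? d]]].
by split=> //; exists i, j.
Qed.

Lemma power_gap_gt0 x : x \in pairs -> 0 < power_gap x.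
Proof. by move=> /pairsP[xM _ _ _ _]; rewrite subn_gt0 sqr_lt. Qed.

Lemma odd_fst x : x \in pairs -> odd x.1.
Proof. by move=> /pairsP[_ x4 _ _ _]; rewrite (divn_eq x.1 4) x4 oddD oddM andbF. Qed.

Lemma power_gap_eq x : x \in pairs ->
  x.1 ^ k = x.2 ^ 2 + core (power_gap x) * sqpart (power_gap x) ^ 2.
Proof.
move=> xp; have [xM _ _ _ _] := pairsP xp.
by rewrite -core_sqpart ?power_gap_gt0 // subnKC // ltnW // sqr_lt.
Qed.

Let pow_Mb m : m < Mb -> m ^ k <= Mb ^ k.
Proof. by move=> mM; rewrite leq_exp2r ?(leq_trans _ k5) // ltnW. Qed.

(** For each m and each n below [q * z ^ 14], [card_core_fiber] leaves at most [Dm] values of a. *)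
Lemma card_core_small :
  #|[set x in pairs | core (power_gap x) < q * z ^ 14]| <= Mb * (Dm * (q * z ^ 14)).
Proof.
have Y0 : 0 < q * z ^ 14 by rewrite muln_gt0 expn_gt0 q0 z0.
rewrite card_sum_fibers -[X in _ <= X * _]card_ord -sum_nat_const.
apply: leq_sum => m _; set S := [set a | _].
(* The default of [insubd] is never taken on [S], where the core is below [q * z ^ 14]. *)
pose g (a : 'I_Ab) : 'I_(q * z ^ 14) := insubd (Ordinal Y0) (core (m ^ k - a ^ 2)).
apply: (@leq_trans (Dm * #|g @: S|)); last first.
  by rewrite leq_mul2l -[X in _ <= X]card_ord max_card orbT.
apply: card_le_fibers => y.
have [->|[a]] := set_0Vmem [set a in S | g a == y]; first by rewrite cards0.
have gE b : b \in [set a in S | g a == y] ->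
    (m, b) \in pairs /\ core (m ^ k - b ^ 2) = y.
  rewrite in_set => /andP[+ /eqP <-]; rewrite in_set in_set => /andP[bp bY].
  by split=> //; rewrite /g val_insubd bY.
move=> aS; have [ap aE] := gE a aS.
have y0 : 0 < y.
  rewrite -aE lt0n; apply: contraTneq (power_gap_gt0 ap) => c0.
  by rewrite (core_sqpart (power_gap_gt0 ap)) /power_gap /= c0 mul0n.
have m0 : 0 < m by have := odd_fst ap => /=; case: (m : nat).
have dm : size (divisors (m ^ k)) <= Dm by apply: hD; rewrite ?expn_gt0 ?m0 // pow_Mb.
apply: leq_trans dm; apply: leq_trans (card_core_fiber k Ab (odd_fst ap) y0).
apply: subset_leq_card; apply/subsetP => b /gE[bp bE].
rewrite inE bE eqxx andbT; have [bM _ _ -> _] := pairsP bp.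
exact: sqr_lt.
Qed.

Let leq_of_sqr a b : a ^ 2 <= b ^ 2 -> a <= b.
Proof. by rewrite leq_sqr. Qed.

(* A pair whose core is small but not tiny has a square divisor w ^ 2 with w = p F / (p r) in a
   range where few pairs have such a divisor. *)
Lemma core_middle_witness x : x \in pairs ->
  q * z ^ 14 <= core (power_gap x) -> core (power_gap x) < Mb ^ 2 ->
  exists w, [/\ t ^ 5 * (q * z ^ 11) <= w, w < c * (q * z ^ 14) & w ^ 2 %| power_gap x].
Proof.
move=> xp; have [xM _ _ _ [i [j d]]] := pairsP xp.
have N0 := power_gap_gt0 xp; have NE := core_sqpart N0.
have /dvdnP[f FE] := dvdn_sqpart N0 d.
set n := core _ in NE *; set F := sqpart _ in NE FE => n_ge n_lt.
have /andP[r1 r2] := rfac_bounds j.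
have F0 : 0 < F by apply: leq_sqpart; rewrite // exp1n dvd1n.
have {}FE : F = (pfac i * f) * rfac j by rewrite FE; ring.
set w := pfac i * f in FE; exists w; set r := rfac j in r1 r2 FE.
(* The gap [n * F ^ 2 = n * (w * r) ^ 2] is known up to constants. Thus [n < Mb ^ 2] bounds [w] from
   below and [n >= q * z ^ 14] bounds it from above. *)
have N_ge : t ^ 29 * (q ^ 2 * z ^ 50) <= n * F ^ 2.
  rewrite -NE; have := sqr_upper xM (ltn_ord x.2); have := pow_lower xM.
  rewrite /power_gap (_ : t ^ 30 * _ = t * (t ^ 29 * (q ^ 2 * z ^ 50))); last by ring.
  rewrite {1 3}tE; move: (x.1 ^ k) (x.2 ^ 2) (t ^ 29 * _) => u v s; clear; lia.
have N_le : n * F ^ 2 <= c * (q ^ 2 * z ^ 50).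
  by rewrite -NE; apply: leq_trans (leq_subr _ _) (pow_upper _).
split.
- apply: leq_of_sqr; have r20 : 0 < (t ^ 2 * z ^ 4) ^ 2 * Mb ^ 2.
    by rewrite muln_gt0 !expn_gt0 muln_gt0 MbE muln_gt0 !expn_gt0 t0 z0.
  rewrite -(leq_pmul2r r20).
  apply: (@leq_trans (n * F ^ 2)).
    apply: leq_trans N_ge; rewrite MbE.
    rewrite (_ : _ * _ = t ^ 28 * (q ^ 2 * z ^ 50)); last by ring.
    by rewrite leq_mul2r leq_exp2l // orbT.
  rewrite FE expnMn mulnCA leq_mul2l; apply/orP; right; rewrite mulnC.
  by apply: leq_mul; rewrite ?leq_sqr // ltnW.
- rewrite -ltn_sqr; have r20 : 0 < (t * z ^ 4) ^ 2 * (q * z ^ 14).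
    by rewrite muln_gt0 expn_gt0 muln_gt0 t0 expn_gt0 z0 muln_gt0 q0 expn_gt0 z0.
  rewrite -(ltn_pmul2r r20).
  apply: (@leq_ltn_trans (n * F ^ 2)).
    rewrite FE (expnMn w r) [leqRHS]mulnCA leq_mul2l; apply/orP; right; rewrite mulnC.
    by apply: leq_mul; rewrite ?leq_sqr.
  apply: leq_ltn_trans N_le _.
  have c0 : 0 < c by rewrite cE expn_gt0 t0.
  rewrite [ltnRHS](_ : _ = c * (q ^ 2 * z ^ 50) * (t ^ 2 * (c * q))); last by ring.
  rewrite -[ltnLHS]muln1 ltn_pmul2l; last by rewrite muln_gt0 c0 muln_gt0 !expn_gt0 q0 z0.
  apply: (@leq_trans (t ^ 2)); first by rewrite tE.
  by rewrite leq_pmulr // muln_gt0 c0.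
by rewrite NE dvdn_mull // FE expnMn dvdn_mulr.
Qed.

(** For each m, sum the bound [(Ab %/ w ^ 2).+1 * Dm] of [card_square_dvd] over the possible w. The
    quotients sum to at most [t ^ 10 * z ^ 14], and the ones add up to the number of w. *)
Lemma card_core_middle :
  #|[set x in pairs | (q * z ^ 14 <= core (power_gap x)) && (core (power_gap x) < Mb ^ 2)]|
    <= Mb * (Dm * (t ^ 10 * z ^ 14 + c * (q * z ^ 14))).
Proof.
set V := c * (q * z ^ 14); set B := [set x in pairs | _].
pose W := (t ^ 5 * (q * z ^ 11)).-2.
have WE : W.+2 = t ^ 5 * (q * z ^ 11).
  rewrite /W; have : t ^ 2 <= t ^ 5 * (q * z ^ 11).
    apply: (@leq_trans (t ^ 5)); first by rewrite leq_exp2l.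
    by rewrite leq_pmulr // muln_gt0 expn_gt0 q0 z0.
  rewrite {1}tE; move: (t ^ 5 * _) => u; clear; lia.
pose R (m : 'I_Mb) v : {set 'I_Ab} :=
  [set a : 'I_Ab | ((m, a) \in pairs) && ((W.+2 + v) ^ 2 %| power_gap (m, a))].
have R_le m v : #|R m v| <= (Ab %/ (W.+2 + v) ^ 2).+1 * Dm.
  have [->|[a]] := set_0Vmem (R m v); first by rewrite cards0.
  rewrite inE => /andP[ap wa].
  have a0 := power_gap_gt0 ap.
  (* [card_square_dvd] needs odd moduli; a square divisor of an odd gap has an odd root. *)
  have om : odd (power_gap (m, a)).
    have := power_gap_eq ap; rewrite -(core_sqpart a0) => /(congr1 odd).
    rewrite oddX (odd_fst ap) orbT oddD oddX /=.
    by have [_ _ /negbTE-> _ _] := pairsP ap.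
  have ow : odd (W.+2 + v).
    apply: contraTT om => /negbTE ow; have /dvdnP[u ->] := wa.
    by rewrite oddM oddX ow /= andbF.
  have dw : size (divisors ((W.+2 + v) ^ 2)) <= Dm.
    apply: hD; first by rewrite expn_gt0.
    apply: leq_trans (dvdn_leq a0 wa) _; apply: leq_trans (leq_subr _ _) _.
    exact: pow_Mb.
  apply: leq_trans (leq_mul (leqnn _) dw).
  apply: leq_trans (card_square_dvd m Ab _ ow); last by apply: leq_trans k5.
  apply: subset_leq_card; apply/subsetP => b; rewrite in_set => /andP[bp wb]; rewrite in_set.
  by have [bM _ _ -> _] := pairsP bp; rewrite (ltnW (sqr_lt bM _)).
have B_le : #|B| <= \sum_m \sum_(v < V) #|R m v|.
  rewrite card_sum_fibers; apply: leq_sum => m _.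
  under eq_bigr => v _ do rewrite -sum1_card big_mkcond /=.
  rewrite exchange_big /= -sum1_card big_mkcond; apply: leq_sum => a _.
  case: ifP => //; rewrite in_set in_set => /andP[ap /andP[n1 n2]].
  have [w [w1 w2 w3]] := core_middle_witness ap n1 n2.
  have wV : w - W.+2 < V by apply: leq_ltn_trans w2; rewrite leq_subr.
  rewrite (bigD1 (Ordinal wV)) //= inE ap /= subnKC; last by rewrite WE.
  by rewrite w3 leq_addr.
apply: leq_trans B_le _; rewrite -[X in _ <= X * _]card_ord -sum_nat_const.
apply: leq_sum => m _.
apply: (@leq_trans (\sum_(v < V) (Ab %/ (W.+2 + v) ^ 2).+1 * Dm)); first exact: leq_sum.
rewrite -big_distrl /= mulnC leq_mul2l; apply/orP; right.
under eq_bigr => v _ do rewrite -addn1.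
rewrite big_split /= sum_nat_const card_ord muln1 leq_add2r.
have W1 : t ^ 4 * (q * z ^ 11) <= W.+1.
  rewrite -ltnS WE (_ : t ^ 5 * _ = t * (t ^ 4 * (q * z ^ 11))); last by ring.
  by rewrite -[ltnLHS]mul1n ltn_pmul2r // muln_gt0 expn_gt0 t0 muln_gt0 expn_gt0 q0 z0.
have u0 : 0 < t ^ 4 * (q * z ^ 11) by rewrite muln_gt0 expn_gt0 t0 muln_gt0 expn_gt0 q0 z0.
rewrite -(leq_pmul2r u0); apply: leq_trans (leq_mul (leqnn _) W1) _.
rewrite big_distrl; apply: leq_trans (sum_div_sqr Ab W V) _.
by rewrite AbE (_ : t ^ 10 * _ * _ = t ^ 14 * (q * z ^ 25)) //; ring.
Qed.

Definition large_core_pairs : {set 'I_Mb * 'I_Ab} :=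
  [set x in pairs | (q * z ^ 14 <= core (power_gap x)) && (Mb ^ 2 <= core (power_gap x))].

Lemma card_large_core_pairs : q * z ^ 25 <= Dm ^ 5 * #|large_core_pairs|.
Proof.
have split_pairs : #|pairs| <= #|large_core_pairs| + Mb * (Dm * (q * z ^ 14)) +
    Mb * (Dm * (t ^ 10 * z ^ 14 + c * (q * z ^ 14))).
  apply: leq_trans (leq_add (leq_add (leqnn _) card_core_small) card_core_middle).
  apply: leq_trans (leq_trans (subset_leq_card _) (leq_card_setU _ _))
    (leq_add (leq_card_setU _ _) (leqnn _)).
  apply/subsetP => x xp; rewrite in_setU in_setU /large_core_pairs in_set in_set in_set xp /=.
  by case: leqP => //=; case: leqP.
have c0 : t ^ 10 <= c.
  rewrite cE leq_exp2l //; apply: (@leq_trans (7 * 5)) => //.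
  by rewrite leq_mul2l k5.
(* The discarded pairs have order [q * z ^ 24], one factor [z] less than [pairs]; by [hz] this
   factor outweighs the constants and [Dm ^ 6]. *)
have bad : Dm ^ 5 * (Mb * (Dm * (q * z ^ 14)) + Mb * (Dm * (t ^ 10 * z ^ 14 + c * (q * z ^ 14))))
    <= q * z ^ 25.
  have -> : Dm ^ 5 * (Mb * (Dm * (q * z ^ 14)) + Mb * (Dm * (t ^ 10 * z ^ 14 + c * (q * z ^ 14)))) =
    t ^ 7 * Dm ^ 6 * z ^ 24 * (q + t ^ 10 + c * q) by rewrite MbE; ring.
  have -> : q * z ^ 25 = z * (z ^ 24 * q) by ring.
  apply: leq_trans (leq_mul hz (leqnn _)).
  have -> : t ^ 9 * c * Dm ^ 6 * (z ^ 24 * q) = t ^ 7 * Dm ^ 6 * z ^ 24 * (t ^ 2 * (c * q)) by ring.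
  rewrite leq_mul2l; apply/orP; right.
  have cq1 : q <= c * q by rewrite leq_pmull // cE expn_gt0 t0.
  have cq2 : t ^ 10 <= c * q by apply: leq_trans c0 _; rewrite leq_pmulr.
  rewrite {2}tE; move: (t ^ 10) (c * q) cq1 cq2 => u v; clear; lia.
have t6 : t * (q * z ^ 25) <= t ^ 6 * (q * z ^ 25).
  by rewrite leq_mul2r -{1}[t]expn1 leq_exp2l ?orbT.
have := leq_trans card_pairs_ge (leq_mul (leqnn (Dm ^ 5)) split_pairs).
rewrite -addnA mulnDr.
move: t6 bad; rewrite {1}tE.
move: (Dm ^ 5 * #|large_core_pairs|) (q * z ^ 25) (t ^ 6 * _) (Dm ^ 5 * (_ + _)).
clear; lia.
Qed.

(** Modulo 4, the equation m ^ k = a ^ 2 + n F ^ 2 reads 1 = 0 + n. The upper bound on n holds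
    because b = p r is at least 2 z ^ 10 and divides F. *)
Lemma large_core_pairsP x : x \in large_core_pairs ->
  [/\ [/\ 1 < x.1, odd x.1, coprime x.2 x.1
        & x.1 ^ k = x.2 ^ 2 + core (power_gap x) * sqpart (power_gap x) ^ 2],
      squarefree (core (power_gap x)), core (power_gap x) %% 4 = 1,
      4 * core (power_gap x) <= c * (q ^ 2 * z ^ 30) &
      q * z ^ 14 <= core (power_gap x) /\ Mb ^ 2 <= core (power_gap x)].
Proof.
rewrite in_set => /andP[xp /andP[n1 n2]].
have [xM x4 x2 cx [i [j d]]] := pairsP xp.
have N0 := power_gap_gt0 xp; have NE := core_sqpart N0.
have x1 : 1 < x.1.
  apply: leq_trans xM; apply: (@leq_trans (t ^ 6)); last by rewrite leq_pmulr // expn_gt0 z0.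
  by apply: (@leq_trans (t ^ 1)); rewrite ?leq_exp2l // expn1 tE.
have ox := odd_fst xp.
have dE := power_gap_eq xp.
split=> //; first exact: core_squarefree.
- set n := core _ in dE *; set F := sqpart _ in dE.
  have oF : odd F.
    have : odd (x.2 ^ 2 + n * F ^ 2) by rewrite -dE oddX ox orbT.
    by rewrite oddD !oddX (negbTE x2) /= oddM oddX /= => /andP[].
  have sq4 u : odd u -> u ^ 2 %% 4 = 1.
    move=> ou; rewrite -[u]odd_double_half ou -mul2n.
    by rewrite (_ : (1 + 2 * u./2) ^ 2 = (u./2 * u./2 + u./2) * 4 + 1) ?modnMDl //; ring.
  have : x.1 ^ k %% 4 = (x.2 ^ 2 + n * F ^ 2) %% 4 by rewrite dE.
  have e2 : x.2 ^ 2 %% 4 = 0.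
    by rewrite -[x.2 : nat]odd_double_half (negbTE x2) add0n -mul2n expnMn modnMr.
  have -> : (x.2 ^ 2 + n * F ^ 2) %% 4 = n %% 4.
    by rewrite -modnDm e2 add0n modn_mod -modnMmr sq4 // muln1.
  by rewrite -modnXm x4 exp1n.
have /andP[p1 _] := pfac_bounds i; have /andP[r1 _] := rfac_bounds j.
have z20 : 0 < z ^ 20 by rewrite expn_gt0 z0.
rewrite -(leq_pmul2r z20).
have -> : c * (q ^ 2 * z ^ 30) * z ^ 20 = c * (q ^ 2 * z ^ 50) by ring.
apply: leq_trans (pow_upper (ltn_ord x.1)).
apply: (@leq_trans (power_gap x)); last exact: leq_subr.
rewrite [leqRHS]NE.
have -> : 4 * core (power_gap x) * z ^ 20 = core (power_gap x) * (2 * z ^ 10) ^ 2 by ring.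
rewrite leq_mul2l leq_sqr; apply/orP; right.
apply: (@leq_trans (pfac i * rfac j)).
  have -> : 2 * z ^ 10 = z ^ 6 * (2 * z ^ 4) by ring.
  apply: leq_mul; last by rewrite -{1}tE.
  by apply: leq_trans p1; rewrite leq_pmull.
apply: dvdn_leq; last exact: dvdn_sqpart.
by apply: leq_sqpart; rewrite // exp1n dvd1n.
Qed.

End Count.

(** * Fixing the parameters for large z *)

Lemma divisors_bound_uniform (t k J : nat) : 0 < J -> 0 < t ->
  exists2 z0, 0 < z0 & forall z, z0 <= z ->
    exists2 Dm, Dm ^ J <= z &
      forall x, 0 < x -> x <= (t * z ^ 10) ^ k -> size (divisors x) <= Dm.
Proof.
(* The exponent turns C t ^ k z ^ (10 k) <= z ^ (10 k + 1) into a bound [z] for the [J]-th power of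
   the number of divisors, by extracting a root of order 10 k + 1. *)
move=> J0 t0; have [C C0 hC] := divisors_bound (J * (10 * k).+1).
exists (C * t ^ k) => [|z hz]; first by rewrite muln_gt0 C0 expn_gt0 t0.
exists (\max_(x < ((t * z ^ 10) ^ k).+1 | 0 < x) size (divisors x)); last first.
  move=> x x0 xM; have xM' : x < ((t * z ^ 10) ^ k).+1 by rewrite ltnS.
  exact: (@leq_bigmax_cond _ _ (fun x : 'I_ _ => size (divisors x)) (Ordinal xM')).
have z0 : 0 < z by apply: leq_trans hz; rewrite muln_gt0 C0 expn_gt0 t0.
apply: (big_ind (fun u => u ^ J <= z)) => [|u v hu hv|x x0].
- by rewrite exp0n.
- by rewrite /maxn; case: ifP.
have := hC x x0; rewrite expnM => h.
rewrite -(@leq_exp2r _ _ (10 * k).+1) //; apply: leq_trans h _.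
have xM : x <= (t * z ^ 10) ^ k by rewrite -ltnS.
apply: leq_trans (leq_mul (leqnn C) xM) _.
by rewrite expnMn mulnA -expnM expnS leq_mul2r hz orbT.
Qed.

(** The family has at least z ^ (5 k - 5 / J) members, so 1 / J measures the loss in the exponent.
    The last two conditions are the ones that make classes distinct and of exact order k. *)
Lemma repr_family (k J : nat) : 5 <= k -> odd k -> 12 <= J ->
  exists2 z0, 0 < z0 & forall z, z0 <= z ->
    exists (s : seq (nat * nat)) (d : nat * nat -> nat),
      [/\ uniq s, z ^ (5 * k * J) <= z ^ 5 * size s ^ J &
       forall x, x \in s ->
       [/\ exists f, [/\ 1 < x.1, odd x.1, coprime x.2 x.1 & x.1 ^ k = x.2 ^ 2 + d x * f ^ 2],
         squarefree (d x) /\ d x %% 4 = 1, 4 * d x <= 2 ^ (7 * k) * z ^ (10 * (k - 2)),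
         forall y, y \in s -> x.1 * y.1 < d x &
         forall g, g %| k -> g < k -> x.1 ^ g < d x]].
Proof.
move=> k5 ok J12; have J0 : 0 < J by apply: leq_trans J12.
have [t tE] : exists t, t = 2 by exists 2.
have t7 : 0 < t ^ 7 by rewrite tE.
have [z1 z10 hz1] := divisors_bound_uniform k J0 t7.
exists (z1 + (t ^ 9 * t ^ (7 * k)) ^ 2) => [|z hz]; first by rewrite addn_gt0 z10.
have [Dm DJ hD] := hz1 z (leq_trans (leq_addr _ _) hz).
have z0 : 0 < z by apply: leq_trans z10 (leq_trans (leq_addr _ _) hz).
have Dm0 : 0 < Dm.
  by apply: leq_trans (hD 1 isT _); rewrite // expn_gt0 muln_gt0 t7 expn_gt0 z0.
(* Compared after squaring: the squared constant is at most [z] by the choice of the threshold, and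
   [Dm ^ 12 <= Dm ^ J <= z]. *)
have hzD : t ^ 9 * t ^ (7 * k) * Dm ^ 6 <= z.
  rewrite -leq_sqr expnMn -expnM -[leqRHS]mulnn; apply: leq_mul.
    exact: leq_trans (leq_addl _ _) hz.
  by apply: leq_trans DJ; rewrite leq_pexp2l.
have [q qE] : exists q, q = z ^ (5 * (k - 5)) by eexists.
have [c cE] : exists c, c = t ^ (7 * k) by eexists.
have [Mb MbE] : exists Mb, Mb = t ^ 7 * z ^ 10 by eexists.
have [Ab AbE] : exists Ab, Ab = t ^ 14 * (q * z ^ 25) by eexists.
have [T TE] : exists T, T = t ^ 5 * (q * z ^ 5) by eexists.
rewrite -MbE in hD; rewrite -cE in hzD.
pose G := large_core_pairs t k z q Mb Ab.
have cardG := card_large_core_pairs tE k5 z0 qE cE MbE AbE TE hD hzD.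
have GP x := large_core_pairsP tE k5 z0 qE cE MbE AbE (x := x).
pose emb (x : 'I_Mb * 'I_Ab) := (x.1 : nat, x.2 : nat).
have emb_inj : injective emb by move=> [a b] [a' b'] [/val_inj-> /val_inj->].
exists [seq emb x | x <- enum G], (fun x => core (x.1 ^ k - x.2 ^ 2)); split.
- by rewrite map_inj_uniq ?enum_uniq.
- rewrite size_map -cardE expnM.
  have -> : z ^ (5 * k) = q * z ^ 25.
    by rewrite qE -expnD; congr (z ^ _); move: k5; clear; lia.
  apply: (@leq_trans ((Dm ^ 5 * #|G|) ^ J)); first by rewrite leq_exp2r.
  by rewrite expnMn leq_mul2r -expnM mulnC expnM leq_exp2r ?DJ ?orbT.
move=> u /mapP[x]; rewrite mem_enum => xG ->.
have [[x1 ox cx xE] sq m4 small [n1 n2]] := GP x xG.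
rewrite /=; split.
- by exists (sqpart (power_gap k x)).
- by [].
- apply: leq_trans small _; have -> : 2 ^ (7 * k) = c by rewrite cE tE.
  rewrite leq_mul2l qE -expnM -expnD.
  apply/orP; right; rewrite leq_pexp2l //; move: k5; clear; lia.
- move=> v /mapP[y]; rewrite mem_enum => yG -> /=.
  apply: leq_trans n2; rewrite -mulnn.
  by apply: ltn_mul.
move=> g gk gltk.
have [g1|g1] := eqVneq g 1.
  rewrite g1 expn1; apply: leq_trans (ltn_ord x.1) (leq_trans _ n2).
  by rewrite -mulnn leq_pmulr // MbE muln_gt0 t7 expn_gt0 z0.
(* A proper divisor of the odd [k] other than 1, and its cofactor, are odd and at least 3. *)
have g3 : 3 <= g /\ 3 * g <= k.
  move: gk gltk g1 ok k5 => /dvdnP[h ->]; rewrite oddM.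
  move=> gltk g1 /andP[oh og] _; split; first by case: (g) og g1 => [|[|[]]].
  rewrite leq_mul2r; apply/orP; right; case: h oh gltk => [|[|[]]] // _.
  by rewrite mul1n ltnn.
have [g3a g3b] := g3.
apply: (@leq_trans (Mb ^ g)); first by rewrite ltn_exp2r ?(leq_trans _ g3a).
apply: leq_trans n1; rewrite qE -expnD.
(* The exponents compare as 11 g <= 5 k - 11, true since 3 g <= k and k >= 9. *)
apply: (@leq_trans ((z * z ^ 10) ^ g)).
  rewrite MbE leq_exp2r ?(leq_trans _ g3a) // leq_mul2r; apply/orP; right.
  apply: leq_trans hzD; rewrite -mulnA; apply: (@leq_trans (t ^ 9)).
    by rewrite leq_pexp2l // tE.
  by rewrite leq_pmulr // muln_gt0 cE !expn_gt0 Dm0 tE.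
rewrite -expnS -expnM leq_pexp2l //; move: g3a g3b k5; clear; lia.
Qed.

(** * Ideal classes *)

From mathcomp Require Import all_field.
From mathcomp Require Import all_classical all_reals all_analysis.
From mathcomp Require Import finmap zify ring lra.

Import Order.TTheory GRing.Theory Num.Theory.
Import numFieldNormedType.Exports.

Local Open Scope classical_set_scope.
Local Open Scope ring_scope.

Lemma squarefree_rat_int (n : nat) (q : rat) (c : int) :
  squarefree n -> n%:Q * q ^+ 2 = c%:~R -> exists z : int, q = z%:~R.
Proof.
move=> sqn h; exists (numq q).
have d0 : (denq q)%:~R != 0 :> rat by rewrite intr_eq0 denq_eq0.
have E : n%:Z * numq q ^+ 2 = c * denq q ^+ 2.
  apply: (@intr_inj rat); rewrite !expr2 !rmorphM /= -h.
  by move: (divq_num_den q) d0; move: (numq q) (denq q) => N D <- D0; field.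
have : (`|denq q| ^ 2 %| n)%N.
  have cop : coprime (`|denq q| ^ 2) (`|numq q| ^ 2).
    by rewrite coprimeXl // coprimeXr // coprime_sym coprime_num_den.
  rewrite -(Gauss_dvdl _ cop); apply/dvdnP; exists `|c|%N.
  by rewrite -!abszX -[n]/`|n%:Z|%N -!abszM E.
move=> /sqn d1; rewrite -{1}[q]divq_num_den.
have -> : denq q = 1 by rewrite -[denq q]gez0_abs ?d1 // ltW // denq_gt0.
by rewrite divr1.
Qed.

Lemma normz_eq0 (n : nat) (x y : int) :
  (0 < n)%N -> x ^+ 2 + n%:Z * y ^+ 2 = 0 -> x = 0 /\ y = 0.
Proof.
move=> n0 E; have x0 := sqr_ge0 x; have y0 : 0 <= n%:Z * y ^+ 2 by rewrite mulr_ge0 ?sqr_ge0.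
have /eqP : x ^+ 2 = 0 by lia.
have /eqP : n%:Z * y ^+ 2 = 0 by lia.
rewrite mulf_eq0 !expf_eq0 /= => /orP[/eqP|/eqP-> /eqP->] //; lia.
Qed.

(** An element of norm below n is a rational integer; this is where all the size conditions on m
    enter. *)
Lemma normz_small (n c : nat) (x y : int) :
  (`|(x ^+ 2 + n%:Z * y ^+ 2)%R| <= c)%N -> (c < n)%N -> y = 0.
Proof.
move=> le_c lt_n; apply/eqP/negPn/negP => y0.
have y2 : 0 < y ^+ 2 by rewrite exprn_even_gt0.
have : n%:Z <= n%:Z * y ^+ 2 by rewrite ler_peMr //; lia.
have := sqr_ge0 x; lia.
Qed.

(** * The field of discriminant -4 n and its ring of integers *)

Section Order.
Variables (n : nat) (n_sqfree : squarefree n) (n_mod4 : (n %% 4 = 1)%N) (n_gt1 : (1 < n)%N).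

Definition disc : int := - (4 * n)%N%:Z.
Definition omega : algC := sqrtC disc%:~R / 2.
Definition fieldK := quadratic_field disc.
Definition ringO := ring_of_integers fieldK.
Definition zomega (x y : int) : algC := x%:~R + y%:~R * omega.

Lemma omega2 : omega ^+ 2 = - n%:R.
Proof.
by rewrite /omega expr_div_n sqrtCK /disc rmorphN /= -pmulrn natrM; field.
Qed.

Lemma omega_conj : omega^* = - omega.
Proof.
have /eqP : omega^* ^+ 2 = omega ^+ 2.
  by rewrite -rmorphXn /= omega2 rmorphN /= conjC_nat.
rewrite eqf_sqr => /orP[/eqP omR|/eqP //].
have omr : omega \is Num.real by rewrite CrealE omR.
have := real_exprn_even_ge0 omr (isT : ~~ odd 2); rewrite omega2 oppr_ge0 lern0.
by move: n_gt1; case: (n).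
Qed.

Lemma zomegaM x y x' y' :
  zomega x y * zomega x' y' = zomega (x * x' - n%:Z * (y * y')) (x * y' + y * x').
Proof.
rewrite /zomega !(rmorphD, rmorphN, rmorphM) /= -pmulrn.
transitivity (x%:~R * x'%:~R + (x%:~R * y'%:~R + y%:~R * x'%:~R) * omega +
    y%:~R * y'%:~R * omega ^+ 2).
  ring.
rewrite omega2; ring.
Qed.

Lemma zomega_inj x y x' y' : zomega x y = zomega x' y' -> x = x' /\ y = y'.
Proof.
move=> E; have : zomega (x - x') (y - y') = 0.
  by move: E; rewrite /zomega !rmorphB /= => E; rewrite mulrBl addrACA -opprD -E subrr.
move=> /(congr1 ( *%R^~ (zomega (x - x') (- (y - y'))))).
rewrite zomegaM mul0r.
have -> : (x - x') * - (y - y') + (y - y') * (x - x') = 0 by ring.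
rewrite {1}/zomega mul0r addr0 => /eqP; rewrite intr_eq0 => /eqP h.
have [/eqP + /eqP] : x - x' = 0 /\ y - y' = 0.
  by apply: (@normz_eq0 n); rewrite ?(ltnW n_gt1) // -h; ring.
by rewrite !subr_eq0 => /eqP-> /eqP->.
Qed.

Lemma omega_Aint : omega \in Aint.
Proof.
apply: (@root_monic_Aint ('X^2 - (- n%:R)%:P)).
- by rewrite rootE !hornerE omega2 subrr.
- exact: monicXnsubC.
apply/polyOverP => i; rewrite coefB coefXn coefC.
by rewrite rpredB ?rpred_nat //; case: ifP; rewrite ?rpredN ?rpred_nat ?rpred0.
Qed.

(** Trace and norm of an integer are rational integers. As n is squarefree, both coordinates are
    then half-integers A / 2 and B / 2, and A ^ 2 + n B ^ 2 = 4 c with n = 1 mod 4 forces A and B to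
    be even. *)
Lemma ringO_zomega z : ringO z <-> exists x y : int, z = zomega x y.
Proof.
split=> [[[a [b zE]] zA]|[x [y ->]]]; last first.
  split.
    exists x%:~R, (y%:~R / 2).
    by rewrite /zomega /omega !ratr_int fmorph_div /= ratr_int ratr_nat; field.
  by apply: rpredD; rewrite ?Aint_int //; apply: rpredM; rewrite ?Aint_int ?omega_Aint.
have [b' {}zE] : exists b', z = ratr a + ratr b' * omega.
  by exists (2 * b); rewrite zE /omega rmorphM /= ratr_nat; field.
have zc : z^* = ratr a - ratr b' * omega.
  rewrite zE rmorphD /= [(ratr b' * omega)^*]rmorphM /= omega_conj !conj_Crat ?Crat_rat //; ring.
have zcA : z^* \in Aint by rewrite Aint_aut.
have [A AE] : exists A : int, 2 * a = A%:~R.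
  have : (ratr (2 * a) : algC) \is a Num.int.
    apply: Cint_rat_Aint; first exact: Crat_rat.
    have -> : ratr (2 * a) = z + z^* by rewrite zc zE rmorphM /= ratr_nat; ring.
    exact: rpredD.
  move=> /intrP[A hA]; exists A; apply: (fmorph_inj (ratr : {rmorphism rat -> algC})).
  by rewrite /= hA ratr_int.
have [c cE] : exists c : int, a ^+ 2 + n%:Q * b' ^+ 2 = c%:~R.
  have : (ratr (a ^+ 2 + n%:Q * b' ^+ 2) : algC) \is a Num.int.
    apply: Cint_rat_Aint; first exact: Crat_rat.
    have -> : ratr (a ^+ 2 + n%:Q * b' ^+ 2) = z * z^*.
      rewrite zc zE !expr2 rmorphD /= !rmorphM /= ratr_int -pmulrn.
      rewrite -[n%:R]opprK -omega2; ring.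
    exact: rpredM.
  move=> /intrP[c hc]; exists c; apply: (fmorph_inj (ratr : {rmorphism rat -> algC})).
  by rewrite /= hc ratr_int.
have [B BE] : exists B : int, 2 * b' = B%:~R.
  apply: (@squarefree_rat_int n _ (4 * c - A ^+ 2)) => //.
  rewrite expr2 rmorphB /= !rmorphM /= -cE -AE; ring.
have E : A ^+ 2 + n%:Z * B ^+ 2 = 4 * c.
  apply: (@intr_inj rat); rewrite !expr2 rmorphD /= !rmorphM /= -cE -AE -BE; ring.
have [q nq] : exists q : nat, n = (4 * q + 1)%N by exists (n %/ 4)%N; lia.
have par (x : int) : exists y, x = 2 * y \/ x = 2 * y + 1 by exists (x %/ 2)%Z; lia.
have [x hx] := par A; have [y hy] := par B.
have [Ax By] : A = 2 * x /\ B = 2 * y.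
  by move: E; rewrite nq; case: hx => ->; case: hy => ->; lia.
exists x, y; rewrite zE /zomega.
have -> : a = x%:~R by move: AE; rewrite Ax rmorphM /=; lra.
have -> : b' = y%:~R by move: BE; rewrite By rmorphM /=; lra.
by rewrite !ratr_int.
Qed.

Lemma ringO_intE (x : int) : x%:~R = zomega x 0.
Proof. by rewrite /zomega mul0r addr0. Qed.

Lemma zomegaD x y x' y' : zomega x y + zomega x' y' = zomega (x + x') (y + y').
Proof. by rewrite /zomega !rmorphD /=; ring. Qed.

Lemma ringO_int (x : int) : ringO x%:~R.
Proof. by apply/ringO_zomega; exists x, 0; apply: ringO_intE. Qed.

Lemma ringO_nat (x : nat) : ringO x%:R.
Proof. exact: (ringO_int x). Qed.

Lemma ringO_add x y : ringO x -> ringO y -> ringO (x + y).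
Proof.
move=> /ringO_zomega[x1 [x2 ->]] /ringO_zomega[y1 [y2 ->]]; apply/ringO_zomega.
by rewrite zomegaD; do 2 eexists.
Qed.

Lemma ringO_mul x y : ringO x -> ringO y -> ringO (x * y).
Proof.
move=> /ringO_zomega[x1 [x2 ->]] /ringO_zomega[y1 [y2 ->]]; apply/ringO_zomega.
by rewrite zomegaM; do 2 eexists.
Qed.

Lemma ringO_exp x i : ringO x -> ringO (x ^+ i).
Proof.
move=> Ox; elim: i => [|i IH]; first by rewrite expr0; apply: (ringO_nat 1).
by rewrite exprS; apply: ringO_mul.
Qed.

Lemma fieldK_mul x y : fieldK x -> fieldK y -> fieldK (x * y).
Proof.
move=> [a [b ->]] [c [d ->]].
exists (a * c + disc%:~R * (b * d)), (a * d + b * c).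
rewrite !(rmorphD, rmorphM) /= ratr_int; set w := sqrtC _.
transitivity (ratr a * ratr c + ratr b * ratr d * w ^+ 2 +
   (ratr a * ratr d + ratr b * ratr c) * w); first by ring.
by rewrite sqrtCK; ring.
Qed.

Lemma fieldK_inv x : fieldK x -> fieldK x^-1.
Proof.
move=> [a [b xE]].
have [->|x0] := eqVneq x 0.
  by exists 0, 0; rewrite invr0 rmorph0 mul0r addr0.
pose N := a ^+ 2 - disc%:~R * b ^+ 2.
set w := sqrtC disc%:~R in xE.
have NE : ratr N = x * (ratr a - ratr b * w).
  rewrite xE /N !expr2 rmorphB /= !rmorphM /= ratr_int -(sqrtCK disc%:~R) -/w; ring.
have N0 : N != 0.
  apply/eqP => N0; have : a ^+ 2 + (4 * n)%:Q * b ^+ 2 = 0.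
    by rewrite -N0 /N /disc rmorphN /= -pmulrn; ring.
  have b2 : 0 <= (4 * n)%:Q * b ^+ 2 by apply: mulr_ge0; [rewrite ler0z | apply: sqr_ge0].
  move=> /eqP; rewrite (paddr_eq0 (sqr_ge0 a) b2).
  rewrite !(expf_eq0, mulf_eq0) /= => /andP[/eqP a0 /orP[|/eqP b0]].
    by rewrite intr_eq0; move: n_gt1; lia.
  by move/eqP: x0; apply; rewrite xE a0 b0 rmorph0 mul0r addr0.
exists (a / N), (- b / N).
have -> : ratr (a / N) = ratr a / ratr N :> algC by rewrite fmorph_div.
have -> : ratr (- b / N) = - ratr b / ratr N :> algC by rewrite fmorph_div /= rmorphN.
rewrite NE.
have x0' : ratr a - ratr b * w != 0.
  apply: contraNneq N0 => e; rewrite -(fmorph_eq0 (ratr : {rmorphism rat -> algC})) /=.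
  by rewrite NE e mulr0.
by rewrite -/w; field; rewrite x0 x0'.
Qed.

Lemma ideal_scaleA x y I : ideal_scale x (ideal_scale y I) = ideal_scale (x * y) I.
Proof.
apply/seteqP; split=> z.
  by move=> [_ [u Iu <-] <-]; exists u; rewrite // mulrA.
by move=> [u Iu <-]; exists (y * u); [exists u | rewrite mulrA].
Qed.

Lemma ideal_scale1 I : ideal_scale 1 I = I.
Proof.
apply/seteqP; split=> z; first by move=> [u Iu <-]; rewrite mul1r.
by exists z; rewrite ?mul1r.
Qed.

Lemma fieldK_1 : fieldK 1. Proof. by have [] := ringO_nat 1. Qed.

Lemma ideal_class_id I : ideal_class fieldK I I.
Proof. by exists 1; rewrite ?ideal_scale1 //; split; [exact: fieldK_1|exact: oner_neq0]. Qed.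

Lemma ideal_class_mul I I' :
  class_mul (ideal_class fieldK I) (ideal_class fieldK I') = ideal_class fieldK (ideal_mul I I').
Proof.
have scale_mul x y : ideal_mul (ideal_scale x I) (ideal_scale y I') =
    ideal_scale (x * y) (ideal_mul I I').
  apply/seteqP; split=> z /=.
    move=> [l [u [v [hu hv zE]]]].
    pose u' i := sval (cid2 (hu i)); pose v' i := sval (cid2 (hv i)).
    have u'P i : I (u' i) /\ x * u' i = u i by rewrite /u'; case: cid2.
    have v'P i : I' (v' i) /\ y * v' i = v i by rewrite /v'; case: cid2.
    exists (\sum_(i < l) u' i * v' i).
      by exists l, u', v'; split=> // i; [case: (u'P i)|case: (v'P i)].
    rewrite zE mulr_sumr; apply: eq_bigr => i _.
    by have [_ <-] := u'P i; have [_ <-] := v'P i; ring.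
  move=> [_ [l [u [v [hu hv ->]]]] <-].
  exists l, (fun i => x * u i), (fun i => y * v i); split=> [i|i|].
  - by exists (u i).
  - by exists (v i).
  by rewrite mulr_sumr; apply: eq_bigr => i _; ring.
apply/seteqP; split=> A.
  move=> [_ [x [Kx x0] ->] [_ [y [Ky y0] ->] <-]].
  by exists (x * y); rewrite ?scale_mul // mulf_neq0 //; split=> //; apply: fieldK_mul.
move=> [x [Kx x0] ->]; exists (ideal_scale x I); first by exists x.
by exists I'; [exact: ideal_class_id | rewrite -[I' in LHS]ideal_scale1 scale_mul mulr1].
Qed.


(** * Powers of the ideal (m, alpha) and the order of its class *)

Section Ideal.
Variables (k m a f : nat).
Hypotheses (m_gt1 : (1 < m)%N) (m_odd : odd m) (cop_am : coprime a m) (k_gt0 : (0 < k)%N).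
Hypothesis norm_alpha : (m ^ k = a ^ 2 + n * f ^ 2)%N.

Definition alpha := zomega a f.

(* The i-th power of the ideal (m, alpha) is (m ^ i, alpha) for 0 < i <= k. *)
Definition idealJ (i : nat) : set algC :=
  [set z | exists y t, [/\ ringO y, ringO t & z = m%:R ^+ i * y + alpha * t]].

Lemma norm_alphaz : m%:Z ^+ k = a%:Z ^+ 2 + n%:Z * f%:Z ^+ 2.
Proof. by rewrite -!natz -!natrX norm_alpha natrD natrM !natrX. Qed.

Lemma ringO_alpha : ringO alpha. Proof. by apply/ringO_zomega; exists a, f. Qed.

(** The quadratic equation of alpha, with trace 2 a and norm m ^ k. *)
Lemma alpha_quad : alpha ^+ 2 + m%:R ^+ k = (2 * a)%:R * alpha.
Proof.
have -> : m%:R ^+ k = zomega (m%:Z ^+ k) 0 by rewrite -ringO_intE rmorphXn.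
rewrite -[(2 * a)%:R]/((2 * a)%N%:Z%:~R) ringO_intE expr2 !zomegaM zomegaD norm_alphaz.
by congr zomega; rewrite ?PoszM; ring.
Qed.

Lemma idealJ_coord i z : idealJ i z -> exists y1 y2 t1 t2 : int,
  z = zomega (m%:Z ^+ i * y1 + (a%:Z * t1 - n%:Z * (f%:Z * t2)))
          (m%:Z ^+ i * y2 + (a%:Z * t2 + f%:Z * t1)).
Proof.
move=> [_ [_ [/ringO_zomega[y1 [y2 ->]] /ringO_zomega[t1 [t2 ->]] ->]]].
exists y1, y2, t1, t2.
have -> : m%:R ^+ i = zomega (m%:Z ^+ i) 0 by rewrite -ringO_intE rmorphXn.
by rewrite !zomegaM zomegaD; congr zomega; ring.
Qed.

Lemma idealJ_sub_O i z : idealJ i z -> ringO z.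
Proof.
by move=> /idealJ_coord[y1 [y2 [t1 [t2 ->]]]]; apply/ringO_zomega; do 2 eexists.
Qed.

Lemma idealJ_add i x y : idealJ i x -> idealJ i y -> idealJ i (x + y).
Proof.
move=> [x1 [x2 [h1 h2 ->]]] [y1 [y2 [h3 h4 ->]]].
by exists (x1 + y1), (x2 + y2); split; [exact: ringO_add|exact: ringO_add|ring].
Qed.

Lemma idealJ_mul i c x : ringO c -> idealJ i x -> idealJ i (c * x).
Proof.
move=> Oc [x1 [x2 [h1 h2 ->]]].
by exists (c * x1), (c * x2); split; [exact: ringO_mul|exact: ringO_mul|ring].
Qed.

Lemma idealJ_m i : idealJ i (m%:R ^+ i).
Proof.
by exists 1, 0; split; [exact: (ringO_nat 1)|exact: (ringO_nat 0)|rewrite mulr1 mulr0 addr0].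
Qed.

Lemma idealJ_alpha i : idealJ i alpha.
Proof.
by exists 0, 1; split; [exact: (ringO_nat 0)|exact: (ringO_nat 1)|rewrite mulr1 mulr0 add0r].
Qed.

Lemma idealJ_0 i : idealJ i 0.
Proof. by rewrite -[0](mul0r alpha); apply: idealJ_mul (idealJ_alpha i); exact: (ringO_nat 0). Qed.

Lemma idealJ_fractional i : fractional_ideal fieldK (idealJ i).
Proof.
split.
- by move=> z /idealJ_sub_O[].
- exact: idealJ_0.
- exact: idealJ_add.
- by move=> c x; apply: idealJ_mul.
- by exists (m%:R ^+ i); [exact: idealJ_m|rewrite expf_neq0 // pnatr_eq0; lia].
exists 1 => [|x /idealJ_sub_O]; last by rewrite mul1r.
by split; [exact: (ringO_nat 1) | exact: oner_neq0].
Qed.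

Lemma idealJ_zero : idealJ 0 = ringO.
Proof.
apply/seteqP; split=> z; first exact: idealJ_sub_O.
move=> Oz; exists z, 0; split=> //; first exact: (ringO_nat 0).
by rewrite expr0 mul1r mulr0 addr0.
Qed.

(** m ^ k is alpha times its conjugate 2 a - alpha. *)
Lemma idealJ_top : idealJ k = ideal_scale alpha ringO.
Proof.
apply/seteqP; split=> z.
  move=> [y [t [Oy Ot ->]]].
  exists (((2 * a)%:R - alpha) * y + t).
    apply: ringO_add => //; apply: ringO_mul => //; apply: ringO_add; first exact: ringO_nat.
    by rewrite -mulN1r; apply: ringO_mul ringO_alpha; exact: (ringO_int (- 1)).
  have -> : m%:R ^+ k = (2 * a)%:R * alpha - alpha ^+ 2 by rewrite -alpha_quad addrC addKr.
  ring.
by move=> [x Ox <-]; rewrite mulrC; apply: idealJ_mul => //; apply: idealJ_alpha.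
Qed.

(** The nontrivial point is that alpha lies in the product. As m is coprime to 2 a, write 1 = c1 (2
    a) + c2 m; then alpha = c1 (alpha ^ 2 + m ^ k) + c2 m alpha by [alpha_quad]. *)
Lemma idealJ_succ i : (i < k)%N -> ideal_mul (idealJ 1) (idealJ i) = idealJ i.+1.
Proof.
move=> ik; apply/seteqP; split=> z.
  move=> [l [u [v [hu hv ->]]]].
  apply: (big_ind (idealJ i.+1)); [exact: idealJ_0|exact: idealJ_add|move=> j _].
  have [y [t [Oy Ot ->]]] := hu j; have [y' [t' [Oy' Ot' ->]]] := hv j.
  exists (y * y'), (m%:R * y * t' + t * (m%:R ^+ i * y') + alpha * t * t').
  split; [exact: ringO_mul| |rewrite [_ ^+ i.+1]exprS expr1; ring].
  have Om : ringO m%:R := ringO_nat m.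
  do ![exact: ringO_alpha|by []|apply: ringO_add|apply: ringO_mul|apply: ringO_exp].
move=> [y [t [Oy Ot ->]]].
have c2am : coprimez (2 * a)%N%:Z m%:Z by rewrite coprimezE /= coprimeMl cop_am coprime2n m_odd.
have [[c1 c2] /= c12] := coprimezP _ _ c2am.
have c12' : c1%:~R * (2 * a)%:R + c2%:~R * m%:R = 1 :> algC.
  by rewrite !pmulrn -!rmorphM -rmorphD c12.
exists 2%N, (fun j : 'I_2 => if j == ord0 then m%:R else alpha),
  (fun j : 'I_2 => if j == ord0 then
      m%:R ^+ i * (y + c1%:~R * m%:R ^+ (k - i.+1) * t) + alpha * (c2%:~R * t)
    else m%:R ^+ i * 0 + alpha * (c1%:~R * t)).
have Om : ringO m%:R := ringO_nat m.
split=> [j|j|].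
- by case: ifP => _; [rewrite -[m%:R]expr1; exact: idealJ_m|exact: idealJ_alpha].
- case: ifP => _; eexists; eexists; split; try reflexivity;
  do ![exact: ringO_alpha|exact: ringO_int|exact: (ringO_nat 0)|by []|apply: ringO_add
      |apply: ringO_mul|apply: ringO_exp].
rewrite big_ord_recl big_ord1 /=.
have mk : m%:R ^+ k = m%:R ^+ i.+1 * m%:R ^+ (k - i.+1) :> algC by rewrite -exprD subnKC.
have q : alpha ^+ 2 + m%:R ^+ i.+1 * m%:R ^+ (k - i.+1) = (2 * a)%:R * alpha.
  by rewrite -mk alpha_quad.
transitivity (m%:R ^+ i.+1 * y + (c1%:~R * (2 * a)%:R + c2%:~R * m%:R) * alpha * t).
  by rewrite c12' mul1r.
rewrite ![_ ^+ i.+1]exprS in q *.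
transitivity (m%:R * m%:R ^+ i * y + c1%:~R * ((2 * a)%:R * alpha) * t + c2%:~R * m%:R * alpha * t).
  ring.
by rewrite -q; ring.
Qed.

Lemma class_exp_idealJ i : (i <= k)%N ->
  class_exp fieldK (ideal_class fieldK (idealJ 1)) i = ideal_class fieldK (idealJ i).
Proof.
elim: i => [|i IH] ik; first by rewrite idealJ_zero.
rewrite /class_exp iterS -/(class_exp _ _ i) IH; last exact: ltnW.
by rewrite ideal_class_mul idealJ_succ.
Qed.

Lemma alpha_neq0 : alpha != 0.
Proof.
apply/eqP => al0; have := idealJ_top; rewrite al0 => JE.
have : idealJ k (m%:R ^+ k) := idealJ_m k.
rewrite JE => -[y _]; rewrite mul0r => /esym/eqP; rewrite expf_eq0 pnatr_eq0.
by move: m_gt1; lia.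
Qed.

Lemma class_idealJ_top : ideal_class fieldK (idealJ k) = class_one fieldK.
Proof.
have [Kal _] := ringO_alpha.
rewrite idealJ_top /class_one -/ringO; apply/seteqP; split=> A [x [Kx x0] ->].
  exists (x * alpha); last by rewrite ideal_scaleA.
  by split; [exact: fieldK_mul|rewrite mulf_neq0 ?alpha_neq0].
exists (x / alpha); last by rewrite ideal_scaleA divfK ?alpha_neq0.
by split; [apply/fieldK_mul/fieldK_inv|rewrite mulf_neq0 ?invr_eq0 ?alpha_neq0].
Qed.

(** Multiply u by the conjugate of alpha: the rational part [u * a] is a multiple of m ^ i, because
    alpha has norm m ^ k, and a is coprime to m. *)
Lemma idealJ_int_dvd i (u : int) : (i <= k)%N -> idealJ i u%:~R -> (m%:Z ^+ i %| u)%Z.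
Proof.
move=> ik /idealJ_coord[y1 [y2 [t1 [t2]]]]; rewrite ringO_intE => /zomega_inj[u1 u2].
have cop : coprimez (m%:Z ^+ i) a%:Z by rewrite coprimezXl // coprimezE coprime_sym.
rewrite -(Gauss_dvdzl _ cop); apply/dvdzP.
exists (a%:Z * y1 + n%:Z * (f%:Z * y2) + m%:Z ^+ (k - i) * t1).
have mk : m%:Z ^+ k = m%:Z ^+ i * m%:Z ^+ (k - i) by rewrite -exprD subnKC.
transitivity (u * a%:Z + n%:Z * f%:Z * 0); first by ring.
rewrite {1}u1 u2.
transitivity ((a%:Z * y1 + n%:Z * (f%:Z * y2)) * m%:Z ^+ i +
   (a%:Z ^+ 2 + n%:Z * f%:Z ^+ 2) * t1); first by ring.
by rewrite -norm_alphaz mk; ring.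
Qed.

(** The ideal times its conjugate lies in (m); the expression is the rational part of a product of
    one element with the conjugate of another. *)
Lemma idealJ_norm_dvd (u v u' v' : int) : idealJ 1 (zomega u v) -> idealJ 1 (zomega u' v') ->
  (m%:Z %| u * u' + n%:Z * (v * v'))%Z.
Proof.
move=> /idealJ_coord[y1 [y2 [t1 [t2 /zomega_inj[-> ->]]]]].
move=> /idealJ_coord[z1 [z2 [s1 [s2 /zomega_inj[-> ->]]]]].
rewrite !expr1.
set p := _ - _; set q := a%:Z * t2 + _; set p' := _ - _; set q' := a%:Z * s2 + _.
have -> : (m%:Z * y1 + p) * (m%:Z * z1 + p') + n%:Z * ((m%:Z * y2 + q) * (m%:Z * z2 + q')) =
  m%:Z * (y1 * (m%:Z * z1 + p') + p * z1 + n%:Z * (y2 * (m%:Z * z2 + q') + q * z2))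
  + (p * p' + n%:Z * (q * q')) by ring.
apply: rpredD; first exact: dvdz_mulr.
have -> : p * p' + n%:Z * (q * q') = m%:Z ^+ k * (t1 * s1 + n%:Z * (t2 * s2)).
  by rewrite norm_alphaz /p /q /p' /q'; ring.
by apply: dvdz_mulr; rewrite -(prednK k_gt0) exprS dvdz_mulr.
Qed.

(** The norm of a generator g divides m ^ (2 i) and m ^ i a, hence m ^ i < n. So g is a rational
    integer, divisible by m since it lies in the ideal; then m divides alpha and therefore a. *)
Lemma idealJ_nonprincipal i g : (0 < i <= k)%N -> (m ^ i < n)%N -> idealJ i <> ideal_scale g ringO.
Proof.
move=> /andP[i0 ik] mn JE.
have Jg : idealJ i g by rewrite JE; exists 1; rewrite ?mulr1 //; exact: (ringO_nat 1).
have := idealJ_m i; rewrite {1}JE => -[_ /ringO_zomega[x1 [x2 ->]] gx].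
have := idealJ_alpha i; rewrite {1}JE => -[_ /ringO_zomega[y1 [y2 ->]] gy].
have /ringO_zomega[u [v gE]] := idealJ_sub_O Jg.
have mE : m%:R ^+ i = zomega (m%:Z ^+ i) 0 by rewrite -ringO_intE rmorphXn.
move: gx gy; rewrite gE zomegaM zomegaM mE => /zomega_inj[h1 h2] /zomega_inj[h3 h4].
pose N := u ^+ 2 + n%:Z * v ^+ 2.
have N1 : (N %| m%:Z ^+ i * m%:Z ^+ i)%Z.
  apply/dvdzP; exists (x1 ^+ 2 + n%:Z * x2 ^+ 2).
  transitivity (m%:Z ^+ i * m%:Z ^+ i + n%:Z * 0 * 0); first by ring.
  by rewrite -{1 2}h1 -{1}h2 -{1}h2 /N; ring.
have N2 : (N %| m%:Z ^+ i * a%:Z)%Z.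
  apply/dvdzP; exists (x1 * y1 + n%:Z * (x2 * y2)).
  transitivity (m%:Z ^+ i * a%:Z + n%:Z * 0 * f%:Z); first by ring.
  by rewrite -h1 -h2 -h3 -h4 /N; ring.
have N3 : (N %| m%:Z ^+ i)%Z.
  have cop : coprime (m ^ i) a by rewrite coprimeXl // coprime_sym.
  move: N1 N2; rewrite !dvdzE !abszM abszX absz_nat => N1 N2.
  have := dvdn_gcd `|N| (m ^ i * m ^ i) (m ^ i * a).
  by rewrite N1 N2 -muln_gcdr (eqP cop) muln1 => ->.
have v0 : v = 0.
  have := dvdn_leq _ N3; rewrite abszX absz_nat expn_gt0 (ltnW m_gt1) => /(_ isT) Nm.
  exact: normz_small Nm mn.
have := idealJ_int_dvd ik; have Ju : idealJ i u%:~R by rewrite ringO_intE -v0 -gE.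
move=> /(_ _ Ju) mu.
have : (m%:Z %| a%:Z)%Z.
  rewrite -h3 v0 mul0r mulr0 subr0; apply: dvdz_mulr; apply: dvdz_trans mu.
  by rewrite -(prednK i0) exprS dvdz_mulr.
rewrite dvdzE /= => ma; move: cop_am; rewrite coprime_sym /coprime.
by move/gcdn_idPl: ma => ->; move: m_gt1; case: (m) => [|[]].
Qed.

(** If the i-th power is trivial with 0 < i < k, so is the power gcd(i, k) by Bezout; this is a
    proper divisor of k, excluded by [idealJ_nonprincipal]. *)
Lemma idealJ_class_has_order :
  (forall g, (g %| k)%N -> (g < k)%N -> (m ^ g < n)%N) ->
  class_has_order fieldK (ideal_class fieldK (idealJ 1)) k.
Proof.
move=> small; split=> //; first by rewrite class_exp_idealJ // class_idealJ_top.
move=> i /andP[i0 ik] ei.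
pose T := class_mul (ideal_class fieldK (idealJ 1)).
have ek : iter k T (class_one fieldK) = class_one fieldK.
  by rewrite -[iter _ _ _]/(class_exp fieldK _ k) class_exp_idealJ // class_idealJ_top.
have mul_per c p : iter p T (class_one fieldK) = class_one fieldK ->
    iter (c * p) T (class_one fieldK) = class_one fieldK.
  by move=> h; elim: c => [//|c IH]; rewrite mulSn iterD IH.
have gk : (gcdn i k < k)%N by apply: leq_ltn_trans ik; apply: dvdn_leq; rewrite ?dvdn_gcdl.
have g0 : (0 < gcdn i k)%N by rewrite gcdn_gt0 i0.
have eg : iter (gcdn i k) T (class_one fieldK) = class_one fieldK.
  have [c d E _] := egcdnP k i0.
  have := mul_per c _ ei; rewrite E addnC iterD.
  by rewrite mul_per.
have := class_exp_idealJ (ltnW gk); rewrite /class_exp -/T eg => E.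
have := ideal_class_id (idealJ (gcdn i k)); rewrite -E => -[g _].
apply: idealJ_nonprincipal; first by rewrite g0 ltnW.
exact: small (dvdn_gcdr _ _) gk.
Qed.

End Ideal.

(** * Distinct pairs give distinct classes *)

Definition repr_power (k m a f : nat) : Prop :=
  [/\ (1 < m)%N, odd m, coprime a m & (m ^ k = a ^ 2 + n * f ^ 2)%N].

(* Multiplying J = x J' by conjugates, the norm of x m' divides m m' < n, so x m' is in Z. *)
Lemma idealJ_scale_int (k m a f m' a' f' : nat) (x : algC) :
  (0 < k)%N -> repr_power k m a f -> repr_power k m' a' f' -> (m * m' < n)%N ->
  idealJ m a f 1 = ideal_scale x (idealJ m' a' f' 1) ->
  exists u : int, [/\ x * m'%:R = u%:~R, (m %| `|u|)%N & (`|u| ^ 2 %| m * m')%N].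
Proof.
move=> k0 [m1 oddm cam normE] [m1' oddm' cam' normE'] mm JE.
have Jg : idealJ m a f 1 (x * m'%:R).
  by rewrite JE; exists m'%:R => //; apply: (idealJ_m m' a' f' 1).
have := idealJ_m m a f 1; rewrite {1}JE expr1 => -[X JX xX].
have := idealJ_alpha m a f 1; rewrite {1}JE => -[Y JY xY].
have /ringO_zomega[u [v gE]] := idealJ_sub_O Jg.
have /ringO_zomega[X1 [X2 XE]] := idealJ_sub_O JX.
have /ringO_zomega[Y1 [Y2 YE]] := idealJ_sub_O JY.
rewrite XE in JX xX; rewrite YE in JY xY.
have : zomega u v * zomega X1 X2 = zomega (m'%:Z * m%:Z) 0.
  by rewrite -gE -ringO_intE rmorphM /= -!pmulrn -xX; ring.
rewrite zomegaM => /zomega_inj[h1 h2].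
have : zomega u v * zomega Y1 Y2 = zomega (m'%:Z * a%:Z) (m'%:Z * f%:Z).
  have -> : zomega (m'%:Z * a%:Z) (m'%:Z * f%:Z) = m'%:R * alpha a f.
    by rewrite /alpha /zomega !rmorphM /= -!pmulrn; ring.
  by rewrite -gE -xY; ring.
rewrite zomegaM => /zomega_inj[h3 h4].
pose N := u ^+ 2 + n%:Z * v ^+ 2.
have m'0 : m'%:Z != 0 by move: m1'; clear; lia.
(* The product of x m' with X is m m', and with Y it is m' alpha. As m' divides the norm of X and
   the rational part of X times the conjugate of Y, one factor m' cancels from each norm
   identity. *)
have [c cE] := dvdzP (idealJ_norm_dvd k0 normE' JX JX).
have [d dE] := dvdzP (idealJ_norm_dvd k0 normE' JX JY).
have N1 : (N %| m%:Z * m'%:Z * m%:Z)%Z.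
  apply/dvdzP; exists c; apply: (mulfI m'0).
  transitivity ((m'%:Z * m%:Z) ^+ 2 + n%:Z * 0 ^+ 2); first by ring.
  rewrite -h1 -h2; transitivity (N * (X1 * X1 + n%:Z * (X2 * X2))); first by rewrite /N; ring.
  by rewrite cE; ring.
have N2 : (N %| m%:Z * m'%:Z * a%:Z)%Z.
  apply/dvdzP; exists d; apply: (mulfI m'0).
  transitivity ((m'%:Z * m%:Z) * (m'%:Z * a%:Z) + n%:Z * (0 * (m'%:Z * f%:Z))); first by ring.
  rewrite -h1 -h2 -h3 -h4.
  transitivity (N * (X1 * Y1 + n%:Z * (X2 * Y2))); first by rewrite /N; ring.
  by rewrite dE; ring.
have N3 : (`|N| %| m * m')%N.
  move: N1 N2; rewrite !dvdzE !abszM !absz_nat => N1 N2.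
  have := dvdn_gcd `|N| (m * m' * m) (m * m' * a).
  by rewrite N1 N2 -muln_gcdr coprime_sym in cam *; rewrite (eqP cam) muln1 => ->.
have v0 : v = 0.
  apply: normz_small mm; apply: dvdn_leq N3.
  by rewrite muln_gt0 !(ltn_trans (ltn0Sn 0)).
have gu : x * m'%:R = u%:~R by rewrite gE v0 -ringO_intE.
exists u; split=> //.
  have := @idealJ_int_dvd k m a f cam normE 1 u k0; rewrite -gu => /(_ Jg).
  by rewrite expr1 dvdzE.
by move: N3; rewrite /N v0 expr0n mulr0 addr0 abszX.
Qed.

(** Applying [idealJ_scale_int] both ways gives m | m' and m' | m. Then u is m or -m, the ideals
    coincide, and so do their k-th powers (alpha) and (alpha'). *)
Lemma idealJ_class_inj (k m a f m' a' f' : nat) :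
  (0 < k)%N -> repr_power k m a f -> repr_power k m' a' f' -> (m * m' < n)%N ->
  ideal_class fieldK (idealJ m a f 1) = ideal_class fieldK (idealJ m' a' f' 1) -> m = m' /\ a = a'.
Proof.
move=> k0 r r' mm clE.
have := ideal_class_id (idealJ m a f 1); rewrite clE => -[x _ Jx].
have := ideal_class_id (idealJ m' a' f' 1); rewrite -clE => -[x' _ Jx'].
have [u [xu mu um]] := idealJ_scale_int k0 r r' mm Jx.
have mm' : (m' * m < n)%N by rewrite mulnC.
have [u' [xu' mu' um']] := idealJ_scale_int k0 r' r mm' Jx'.
have [m1 oddm cam normE] := r; have [m1' oddm' cam' normE'] := r'.
have m0 := ltnW m1; have m0' := ltnW m1'.
have dvd_m p q w : (0 < p)%N -> (p %| w)%N -> (w ^ 2 %| p * q)%N -> (p %| q)%N.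
  by move=> p0 pw wq; rewrite -(dvdn_pmul2l p0) mulnn; apply: dvdn_trans wq; rewrite dvdn_exp2r.
have eqm : m = m'.
  by apply/eqP; rewrite eqn_dvd (dvd_m _ _ _ m0 mu um) (dvd_m _ _ _ m0' mu' um').
subst m'; split=> //.
have um_abs : `|u|%N = m.
  by apply/eqP; rewrite eqn_dvd mu andbT -(@dvdn_pexp2r _ _ 2) // -mulnn.
have mC0 : m%:R != 0 :> algC by rewrite pnatr_eq0 -lt0n.
have x_sign : x = 1 \/ x = -1.
  have [uE|uE] : u = m%:Z \/ u = - m%:Z by move: um_abs; clear; lia.
    by left; apply: (mulIf mC0); rewrite xu uE mul1r.
  by right; apply: (mulIf mC0); rewrite xu uE mulN1r rmorphN.
have JJ : idealJ m a f 1 = idealJ m a' f' 1.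
  rewrite Jx; case: x_sign => ->; first exact: ideal_scale1.
  apply/seteqP; split=> z.
    by move=> [y Jy <-]; apply: idealJ_mul Jy; exact: (ringO_int (-1)).
  move=> Jz; exists (-1 * z); first by apply: idealJ_mul Jz; exact: (ringO_int (-1)).
  by rewrite !mulN1r opprK.
have JJi i : (i <= k)%N -> idealJ m a f i = idealJ m a' f' i.
  elim: i => [|i IH] ik; first by rewrite !idealJ_zero.
  by rewrite -(idealJ_succ oddm cam normE ik) -(idealJ_succ oddm cam' normE' ik) JJ IH // ltnW.
have Jkk := JJi k (leqnn k); rewrite !(idealJ_top normE, idealJ_top normE') in Jkk.
have : ideal_scale (alpha a f) ringO (alpha a' f').
  by rewrite Jkk; exists 1; rewrite ?mulr1 //; exact: (ringO_nat 1).
(* alpha and alpha' have the same norm and differ by a unit of norm 1, which is 1 or -1 since n > 1;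
   the natural numbers [a] and [a'] then agree. *)
move=> [_ /ringO_zomega[u1 [u2 ->]]]; rewrite /alpha zomegaM => /zomega_inj[e1 e2].
have nE : m%:Z ^+ k * (u1 ^+ 2 + n%:Z * u2 ^+ 2) = m%:Z ^+ k.
  rewrite {1}(norm_alphaz normE) (norm_alphaz normE') -e1 -e2; ring.
have u12 : u1 ^+ 2 + n%:Z * u2 ^+ 2 = 1.
  have mk0 : m%:Z ^+ k != 0 by rewrite expf_neq0 // -lt0n.
  by apply: (mulfI mk0); rewrite nE mulr1.
have u20 : u2 = 0 by apply: (@normz_small n 1 u1); rewrite ?u12.
move: u12 e1; rewrite u20 expr0n !mulr0 addr0 subr0 => /eqP; rewrite sqrf_eq1.
by move=> /orP[] /eqP-> {}e1; clear -e1; lia.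
Qed.
End Order.

(** * Passing from pairs to the counting measure *)

Lemma leq_counting (R : realType) (T U : choiceType) (c : T -> U) (s : seq T) (A : set U) :
  uniq s -> {in s &, injective c} -> (forall x, x \in s -> A (c x)) ->
  ((size s)%:R%:E <= @counting U R A)%E.
Proof.
(* On an infinite set [counting] is +oo and the bound is trivial. *)
move=> us cinj sA; rewrite /counting; case: asboolP => [finA|_]; last exact: leey.
rewrite lee_fin ler_nat -(size_map c); apply: uniq_leq_size.
  by rewrite map_inj_in_uniq.
by move=> _ /mapP[x xs ->]; rewrite in_fset_set //; apply/mem_set/sA.
Qed.

Lemma leq_counting_classes (R : realType) (n k : nat) (s : seq (nat * nat)) :
  squarefree n -> (n %% 4 = 1)%N -> (0 < k)%N -> uniq s ->
  (forall x, x \in s -> [/\ exists f, repr_power n k x.1 x.2 f,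
     (forall y, y \in s -> (x.1 * y.1 < n)%N)
     & forall g, (g %| k)%N -> (g < k)%N -> (x.1 ^ g < n)%N]) ->
  ((size s)%:R%:E <= @counting _ R (classes_of_order k (- (4 * n)%N%:Z)))%E.
Proof.
move=> sqn n4 k0 us hs.
(* For n <= 1 the sequence is empty: a member would satisfy 1 < x.1 and x.1 ^ 2 < n. *)
have [n1|n1] := leqP n 1.
  case: s us hs => [_ _|x s _ /(_ x)]; last first.
    rewrite mem_head => /(_ isT)[[f [m1 _ _ _]] /(_ x) + _]; rewrite mem_head => /(_ isT).
    by clear -m1 n1; nia.
  by rewrite /counting; case: asboolP => _; [rewrite lee_fin ler_nat | exact: leey].
pose f x := xget 0%N [set f | repr_power n k x.1 x.2 f].
have fP x : x \in s -> repr_power n k x.1 x.2 (f x).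
  by move=> /hs[ex _ _]; rewrite /f; case: xgetP => [g -> //|none]; case: ex => g /none.
apply: (@leq_counting _ _ _ (fun x => ideal_class (fieldK n) (idealJ n x.1 x.2 (f x) 1))) => //.
  move=> x y xs ys /(idealJ_class_inj sqn n4 n1 k0 (fP x xs) (fP y ys)) [].
    by have [_ + _] := hs x xs; apply.
  by case: (x) (y) => [? ?] [? ?] /= -> ->.
move=> x xs; have [m1 oddm cam normE] := fP x xs; split.
  exists (idealJ n x.1 x.2 (f x) 1) => //.
  exact: (idealJ_fractional sqn n4 n1 m1 oddm cam k0 normE).
by apply: idealJ_class_has_order => //; have [_ _] := hs x xs.
Qed.

(** * The lower bound *)

Lemma fundamental_discriminant_4 (n : nat) : squarefree n -> (n %% 4 = 1)%N ->
  fundamental_discriminant (- (4 * n)%N%:Z).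
Proof.
move=> sq n4; right; exists (- n%:Z); split.
- by rewrite PoszM mulrN.
- right; rewrite (_ : - n%:Z = (- (n %/ 4)%N%:Z - 1) * 4 + 3); last first.
    by rewrite {1}(divn_eq n 4) n4; lia.
  by rewrite modzMDl.
by rewrite abszN.
Qed.

Lemma size_le_sum_fibers (T : eqType) (s : seq T) (d : T -> nat) (r : seq nat) :
  (forall x, x \in s -> d x \in r) ->
  (size s <= \sum_(D <- r) size [seq x <- s | d x == D])%N.
Proof.
move=> sr.
under eq_bigr => D _ do rewrite size_filter -sum1_count big_mkcond /=.
rewrite exchange_big /= -sum1_size big_seq_cond [leqRHS]big_seq_cond.
apply: leq_sum => x; rewrite andbT => /sr xr.
by rewrite -big_mkcond /= sum1_count -has_count; apply/hasP; exists (d x).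
Qed.

(** The pairs are sorted by the discriminant -4 [d x]; within one fibre the classes belong to the
    same field and are distinct. *)
Lemma sum_counting_ge (R : realType) (X : R) (k : nat) (s : seq (nat * nat))
    (d : nat * nat -> nat) : (0 < k)%N -> uniq s ->
  (forall x, x \in s ->
    [/\ exists f, repr_power (d x) k x.1 x.2 f, squarefree (d x) /\ (d x %% 4 = 1)%N,
        (4 * d x)%:R < X, (forall y, y \in s -> (x.1 * y.1 < d x)%N) &
        (forall g, (g %| k)%N -> (g < k)%N -> (x.1 ^ g < d x)%N)]) ->
  ((size s)%:R%:E <=
   \sum_(D \in [set D : nat | [/\ (0 < D)%N, (D%:R < X)%R &
                               fundamental_discriminant (- D%:Z)%R]])
      @counting _ R (classes_of_order k (- D%:Z)%R))%E.
Proof.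
move=> k0 us hs; set S := [set D | _].
(* A sum over a set becomes an ordinary finite sum once its index set is finite, here by D < X. *)
have finS : finite_set S.
  apply: (@sub_finite_set _ _ `I_(Num.bound X)) => [D [_ DX _]|]; last exact: finite_II.
  rewrite /= -(ltr_nat R); apply: (lt_trans DX); apply: archi_boundP.
  by apply: le_trans (ltW DX); rewrite ler0n.
rewrite (fsbig_finite _ _ finS).
have sS x : x \in s -> (4 * d x)%N \in fset_set S.
  move=> /hs[_ [sq n4] dX _ _]; rewrite in_fset_set //; apply/mem_set; split=> //.
    by case: (d x) n4.
  exact: fundamental_discriminant_4.
apply: (@le_trans _ _ (\sum_(D <- fset_set S) size [seq x <- s | (4 * d x)%N == D])%:R%:E).
  by rewrite lee_fin ler_nat; apply: size_le_sum_fibers.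
rewrite natr_sum -sumEFin; apply: lee_sum => D _.
have [->|] := eqVneq [seq x <- s | (4 * d x)%N == D] [::].
  exact: (@leq_counting _ _ _ (fun=> class_one (fieldK 1)) ([::] : seq (nat * nat))).
case E : [seq x <- s | (4 * d x)%N == D] => [//|x s'] _.
have : x \in [seq x <- s | (4 * d x)%N == D] by rewrite E mem_head.
rewrite mem_filter => /andP[/eqP DE xs]; rewrite -E -DE.
have [_ [sq n4] _ _ _] := hs x xs.
apply: leq_counting_classes => //; first exact: filter_uniq.
move=> y; rewrite mem_filter => /andP[/eqP/eqP]; rewrite eqn_pmul2l // => /eqP dE ys.
have [h1 h2 h3 h4 h5] := hs y ys; rewrite -dE; split=> // w.
by rewrite mem_filter => /andP[_]; apply: h4.
Qed.

Theorem corollary2p3 (R : realType) (k : nat) (k_ge5 : (5 <= k)%N)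
    (k_odd : odd k) (eps : R) (eps_gt0 : 0 < eps) :
  exists2 c : R, 0 < c &
    \forall X \near +oo_R,
      ((c * X `^ (1 / 2 + 1 / (k%:R - 2) - eps))%:E <=
       \sum_(D \in [set D : nat | [/\ (0 < D)%N, (D%:R < X)%R &
                                   fundamental_discriminant (- D%:Z)%R]])
          @counting _ R (classes_of_order k (- D%:Z)%R))%E.
Proof.
(* At least 1 / eps for the exponent, and at least 12 for [repr_family]. *)
pose J := (12 + Num.bound eps^-1)%N.
have J12 : (12 <= J)%N by rewrite leq_addr.
have J0 : (0 < J%:R :> R) by rewrite ltr0n.
have Jeps : J%:R^-1 <= eps.
  rewrite -[leRHS]invrK lef_pV2 ?posrE ?invr_gt0 //.
  apply/ltW/(lt_le_trans (archi_boundP _)); first by rewrite invr_ge0 ltW.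
  by rewrite ler_nat leq_addl.
have [z0 z0_gt0 fam] := repr_family k_ge5 k_odd J12.
pose C : R := (2 ^ (7 * k))%N%:R.
have C0 : 0 < C by rewrite ltr0n expn_gt0.
pose L := (10 * (k - 2))%N.
have L0 : (0 < L)%N by rewrite /L; move: k_ge5; clear; lia.
have LE : L%:R = 10 * (k%:R - 2) :> R by rewrite natrM natrB // (leq_trans _ k_ge5).
have kR : 5 <= k%:R :> R by rewrite ler_nat.
pose e : R := L%:R.
have e0 : 0 < e by rewrite ltr0n.
(* The exponent for which [repr_family] gives at least z ^ a pairs. *)
pose a : R := 5 * k%:R - 5 / J%:R.
have J1 : J%:R^-1 <= 1 :> R by rewrite invf_le1 // ler1n; apply: leq_trans J12.
have a0 : 0 <= a by rewrite /a; lra.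
pose kappa := (C^-1) `^ (e^-1) / 4.
have kappa0 : 0 < kappa by rewrite divr_gt0 ?powR_gt0 ?invr_gt0.
exists (kappa `^ a); first exact: powR_gt0.
near=> X.
have X1 : 1 <= X by near: X; apply: nbhs_pinfty_ge; exact: num_real.
have X0 : 0 < X by apply: lt_le_trans X1.
have XC : C * (z0.+1%:R * 4) ^+ L <= X by near: X; apply: nbhs_pinfty_ge; exact: num_real.
pose Y := (X / C) `^ e^-1.
have Y0 : 0 < Y by rewrite powR_gt0 // divr_gt0.
have YL : Y ^+ L = X / C.
  by rewrite -powR_mulrn ?ltW // -powRrM mulVf ?gt_eqF // powRr1 // ltW ?divr_gt0.
have YE : Y = 4 * (kappa * X `^ e^-1).
  by rewrite /Y powRM ?ltW ?invr_gt0 // /kappa; field.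
have Y2 : z0.+1%:R * 4 <= Y.
  rewrite -(@ler_pXn2r _ L) ?nnegrE ?(ltW Y0) ?mulr_ge0 ?ler0n //.
  by rewrite YL ler_pdivlMr // mulrC.
(* Halving [Y] makes [C * z ^ L < X] strict; as [Y] is large, [z] is still at least
   [Y / 4 = kappa * X ^ (1 / L)]. *)
pose z := Num.truncn (Y / 2).
have /andP[zY Yz] : z%:R <= Y / 2 < z.+1%:R by apply: truncn_itv; rewrite divr_ge0 // ltW.
have z1 : 1 <= z0%:R :> R by rewrite ler1n.
rewrite -[z0.+1%:R]natr1 in Y2; rewrite -[z.+1%:R]natr1 in Yz.
have z_ge : (z0 <= z)%N by rewrite -(ler_nat R); lra.
have z_gt0 : 0 < z%:R :> R by rewrite ltr0n (leq_trans z0_gt0).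
have zk : kappa * X `^ e^-1 <= z%:R by lra.
have [s [d [us size_s hs]]] := fam z z_ge.
apply: (@le_trans _ _ (size s)%:R%:E); last first.
  apply: (@sum_counting_ge R X k s d) => //; first by apply: leq_trans k_ge5.
  move=> x xs; have [h1 h2 h3 h4 h5] := hs x xs; split=> //.
  apply: (@le_lt_trans _ _ (2 ^ (7 * k) * z ^ L)%N%:R); first by rewrite ler_nat.
  rewrite natrM -/C natrX mulrC -ltr_pdivlMr // -YL ltrXn2r ?ltW //; first by rewrite -lt0n.
  lra.
rewrite lee_fin.
(* The exponent 5 k / (10 (k - 2)) equals 1 / 2 + 1 / (k - 2); the correction from J is at most 1 /
   J <= eps. *)
have X_le : X `^ (1 / 2 + 1 / (k%:R - 2) - eps) <= X `^ (e^-1 * a).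
  apply: ler_powR => //; rewrite /e /a LE.
  have -> : (10 * (k%:R - 2))^-1 * (5 * k%:R - 5 / J%:R) =
      1 / 2 + 1 / (k%:R - 2) - J%:R^-1 * (2 * (k%:R - 2))^-1 :> R.
    field; apply/andP; split; rewrite gt_eqF //; lra.
  have u1 : (2 * (k%:R - 2))^-1 <= 1 :> R by rewrite invf_le1; lra.
  apply: lerB => //; apply: le_trans Jeps.
  by rewrite ler_piMr ?invr_ge0 ?ler0n.
apply: (@le_trans _ _ (kappa `^ a * X `^ (e^-1 * a))).
  by rewrite ler_wpM2l ?powR_ge0.
rewrite powRrM -powRM ?powR_ge0 ?(ltW kappa0) //.
apply: (@le_trans _ _ (z%:R `^ a)).
  by rewrite ge0_ler_powR // nnegrE ?mulr_ge0 ?powR_ge0 // ltW.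
(* [size_s] divided by z ^ 5; taking J-th roots then gives the count. *)
have zJ : z%:R `^ (a * J%:R) <= (size s)%:R ^+ J.
  rewrite -(ler_pM2r (exprn_gt0 5 z_gt0)) -(powR_mulrn 5 (ltW z_gt0)) -powRD; last first.
    by rewrite (gt_eqF z_gt0) implybT.
  have -> : a * J%:R + 5 = (5 * k * J)%N%:R.
    by rewrite /a !natrM; field; rewrite gt_eqF.
  by rewrite !powR_mulrn ?ler0n // -!natrX -natrM ler_nat [leqRHS]mulnC.
have -> : z%:R `^ a = (z%:R `^ (a * J%:R)) `^ J%:R^-1.
  by rewrite -powRrM mulfK // gt_eqF.
have -> : (size s)%:R = ((size s)%:R ^+ J) `^ J%:R^-1 :> R.
  by rewrite -powR_mulrn ?ler0n // -powRrM mulfV ?gt_eqF // powRr1.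
by rewrite ge0_ler_powR ?invr_ge0 ?ler0n // nnegrE ?powR_ge0 ?exprn_ge0 ?ler0n.
Unshelve. all: by end_near.
Qed.
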